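(* Let $\varphi:[0,1]\to[0,\infty)$ and suppose there exist $m_0,c,\alpha>0$ such that $\varphi(m)=cm^\alpha$ on $[0,m_0)$ and $\varphi$ is continuous and bounded uniformly away from $0$ on $[m_0,1]$. Then there exist $s\in(1/2,1)$ and $\gamma\ge 0$ satisfying $$\gamma+\frac{s}{\alpha}>\frac12$$ such that for every $\varepsilon>0$, setting $\ell=\min\{\frac{2s}{\alpha}-\varepsilon,\,2\}$, there is a constant $C>0$, not depending on $T$, with $$\|P^T\|_{\dot{\mathcal H}^{s,\gamma}_0\to L^2(\mathcal A)}\le C\,T^{-\ell/2}\qquad\text{for all }T>1.$$
   Context: $\mathbb S=[0,1]_{\mathrm{per}}$ is the circle of length $1$ (variable $\theta$) and $\mathcal A=[0,1]_m\times\mathbb S_\theta$. Consider the self-adjoint operator $A=-i\varphi(m)\frac{\partial}{\partial\theta}$ acting in $L^2(\mathcal A)$. For $T>0$ the time average is $$P^Tf:=\frac1{2T}\int_{-T}^{T}e^{itA}f\,dt=\frac1{2T}\int_{-T}^{T}f(m,\theta+t\varphi(m))\,dt .$$ Function spaces. Elements $f\in L^2(\mathcal A)=L^2([0,1];L^2(\mathbb S))$ are written via their fibers $f_m\in L^2(\mathbb S)$, $m\in[0,1]$. For $g\in L^2(\mathbb S)$, $\widehat g(k)=\int_0^1 g(\theta)e^{-2\pi i k\theta}\,d\theta$, $k\in\mathbb Z$. Let $L^2_0(\mathbb S)=\{g\in L^2(\mathbb S):\widehat g(0)=0\}$. For $\gamma\ge0$, $$\dot H^\gamma=\Big\{g\in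 L^2_0(\mathbb S):\|g\|_{\dot H^\gamma}^2:=\sum_{k\in\mathbb Z}|k|^{2\gamma}|\widehat g(k)|^2<\infty\Big\}$$ (the $k=0$ term is zero). For $s\in(0,1)$ and $\gamma\ge0$, $\dot{\mathcal H}^{s,\gamma}=W^{s,2}([0,1];\dot H^\gamma)$ is the space of $f\in L^2([0,1];\dot H^\gamma)$ for which $$\|f\|_{s,\gamma}^2:=\|f\|_{L^2([0,1];\dot H^\gamma)}^2+\int_0^1\!\!\int_0^1\frac{\|f_m-f_{m'}\|_{\dot H^\gamma}^2}{|m-m'|^{1+2s}}\,dm\,dm'<\infty .$$ For $s>1/2$ every $f\in\dot{\mathcal H}^{s,\gamma}$ has a representative for which $m\mapsto f_m\in\dot H^\gamma$ is continuous on $[0,1]$, and this representative is always used; then $\dot{\mathcal H}^{s,\gamma}_0=\{f\in\dot{\mathcal H}^{s,\gamma}:f_0=0\}$ (the fiber at $m=0$ vanishes), with norm $\|\cdot\|_{s,\gamma}$. $\|\cdot\|_{\dot{\mathcal H}^{s,\gamma}_0\to L^2(\mathcal A)}$ is the operator norm. *)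

(* Defs.v *)
From mathcomp Require Import all_boot all_order all_algebra.
From mathcomp Require Import complex.
From mathcomp Require Import all_classical all_reals all_analysis.

Set Implicit Arguments.
Unset Strict Implicit.
Unset Printing Implicit Defensive.

Import Order.TTheory GRing.Theory Num.Theory.
Import numFieldNormedType.Exports.

Local Open Scope classical_set_scope.
Local Open Scope ring_scope.
Local Open Scope complex_scope.

Section Defs.
Variable R : realType.

Local Notation leb := (@lebesgue_measure R).
Local Notation unitI := (`[0, 1]%classic : set R).

(* Integral of a complex-valued function, taken on real and imaginary parts. *)
Definition Cintegral (D : set R) (h : R -> R[i]) : R[i] :=
  (\int[leb]_(x in D) complex.Re (h x)) +i*
  (\int[leb]_(x in D) complex.Im (h x)).

(* |z|^2 as an extended real; Normc.normc is the real-valued modulus. *)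
Definition sqmod (z : R[i]) : \bar R := ((Normc.normc z) ^+ 2)%:E.

(* Functions on the circle of length 1 are 1-periodic functions on R. *)
Definition periodic1 (g : R -> R[i]) : Prop := forall x, g (x + 1) = g x.

(* Elements of L^2 spaces are given by Borel representatives; the norms and
   operators below do not depend on the choice of representative. *)
Definition L2_circle (g : R -> R[i]) : Prop :=
  [/\ periodic1 g,
      measurable_fun setT (fun x => complex.Re (g x)),
      measurable_fun setT (fun x => complex.Im (g x)) &
      (\int[leb]_(x in unitI) sqmod (g x) < +oo)%E].

Definition fourier_coef (g : R -> R[i]) (k : int) : R[i] :=
  Cintegral unitI (fun x =>
    g x * (cos (2 * pi * k%:~R * x) -i* sin (2 * pi * k%:~R * x))).

Definition L20_circle (g : R -> R[i]) : Prop :=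
  L2_circle g /\ fourier_coef g 0 = 0.

(* With 0 `^ 0 = 1 the k = 0 term for gamma = 0 is |g^(0)|^2, which vanishes
   on L^2_0. *)
Definition Hdot_sqnorm (gamma : R) (g : R -> R[i]) : \bar R :=
  \esum_(k in [set: int])
    ((`|k%:~R| `^ (2 * gamma))%:E * sqmod (fourier_coef g k))%E.

Definition Hdot (gamma : R) (g : R -> R[i]) : Prop :=
  L20_circle g /\ (Hdot_sqnorm gamma g < +oo)%E.

(* A function on the annulus [0,1] x S is curried, f m being its fiber at m;
   only the values for m in [0,1] matter. *)
Definition L2_annulus_norm (f : R -> R -> R[i]) : \bar R :=
  sqrte (\int[(leb \x leb)%E]_(p in unitI `*` unitI) sqmod (f p.1 p.2))%E.

Definition L2_annulus (f : R -> R -> R[i]) : Prop :=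
  [/\ forall m, m \in `[0, 1] -> periodic1 (f m),
      measurable_fun (unitI `*` [set: R]) (fun p => complex.Re (f p.1 p.2)),
      measurable_fun (unitI `*` [set: R]) (fun p => complex.Im (f p.1 p.2)) &
      (L2_annulus_norm f < +oo)%E].

Definition calH_norm (s gamma : R) (f : R -> R -> R[i]) : \bar R :=
  sqrte (\int[leb]_(m in unitI) Hdot_sqnorm gamma (f m) +
         \int[leb]_(m in unitI) \int[leb]_(m' in unitI)
           (Hdot_sqnorm gamma (fun x => f m x - f m' x)%R *
            ((`|m - m'| `^ (1 + 2 * s))^-1)%:E))%E.

(* W^{s,2}([0,1]; Hdot^gamma); the L^2 part of calH_norm gives
   f \in L^2([0,1]; Hdot^gamma). *)
Definition calH (s gamma : R) (f : R -> R -> R[i]) : Prop :=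
  [/\ L2_annulus f,
      {ae leb, forall m, m \in `[0, 1] -> Hdot gamma (f m)} &
      (calH_norm s gamma f < +oo)%E].

Definition continuous_rep (gamma : R) (f g : R -> R -> R[i]) : Prop :=
  [/\ forall m, m \in `[0, 1] -> Hdot gamma (g m),
      {ae leb, forall m, m \in `[0, 1] ->
         {ae leb, forall x, g m x = f m x}} &
      forall m, m \in `[0, 1] ->
        Hdot_sqnorm gamma (fun x => g m' x - g m x)
          @[m' --> within unitI (nbhs m)] --> 0%E].

(* f_0 is the fiber at 0 of the continuous representative of f. *)
Definition calH0 (s gamma : R) (f : R -> R -> R[i]) : Prop :=
  calH s gamma f /\
  exists2 g, continuous_rep gamma f g & {ae leb, forall x, g 0 x = 0}.

Definition time_average (phi : R -> R) (T : R) (f : R -> R -> R[i])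
    (m x : R) : R[i] :=
  ((2 * T)^-1)%:C * Cintegral `[- T, T]%classic (fun t => f m (x + t * phi m)).

Definition opnorm_calH0_L2 (s gamma : R)
    (P : (R -> R -> R[i]) -> (R -> R -> R[i])) : \bar R :=
  ereal_sup [set L2_annulus_norm (P f) | f in
    [set f | calH0 s gamma f /\ (calH_norm s gamma f <= 1)%E]].

End Defs.

(* Main.v *)
Require Import Defs.
From mathcomp Require Import all_boot all_order all_algebra.
From mathcomp Require Import complex.
From mathcomp Require Import ring lra.
From mathcomp Require Import all_classical all_reals all_analysis.
From mathcomp Require Import measurable_realfun.
Import Order.TTheory GRing.Theory Num.Theory.
Import numFieldNormedType.Exports.
Local Open Scope classical_set_scope.
Local Open Scope ring_scope.

(** On the fiber over [m] the time average is the mean of [f m] over an arc of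
    length [2 * T * phi m].  So everything follows from a bound on the
    integrals of a mean-zero periodic function over arbitrary intervals.  Let
    [S] be the sum of the absolute values of the cosine and sine coefficients
    of such a real function; then its integral over [`[a, b]] is at most
    [2 * S * Num.min (b - a) 1] in absolute value.  Short intervals are handled
    by testing against the Fejer mean of their indicator function
    ([Rintegral_short_le]), and a long interval can be shortened by whole
    periods, over which the integral vanishes ([Rintegral_long_le]).  With
    [gamma = 1], the Cauchy-Schwarz inequality bounds [S] by the homogeneous
    Sobolev norm of the fiber.  Since the square of [Num.min 1 z^-1] is at
    most [z `^ (- l)] for [0 <= l <= 2], this gives the pointwise estimate
    [sqmod_time_average_le]: up to a factor 32, the square of the time
    average is at most [(2 * T * phi m) `^ (- l)] times the squared norm of
    the fiber.

    As [phi m] is at least a multiple of [m `^ alpha] on the whole of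
    [0 < m <= 1], the remaining task is to integrate [m `^ (- (alpha * l))]
    against the squared norm of [f m], where [alpha * l < 2 * s].  That is a
    fractional Hardy inequality ([fractional_hardy]), and it is here that
    [1/2 < s] and the vanishing of the fiber at 0 are used.  The Gagliardo
    seminorm controls how the mean of the squared norm over the dyadic interval
    number [j] exceeds the mean over the next one: the difference of the square
    roots is at most a multiple of [2 ^ (- j (s - 1/2))].  These steps are
    summable, and the means tend to 0 near [m = 0].  The loss [eps] in the exponent makes the
    sum over the dyadic intervals converge.

    The fibers lie in the Sobolev space for almost every [m] only, and the
    definition of their norms says nothing about measurability in [m].  The
    squared norms are therefore replaced by [fourier_energy], a series in the
    real Fourier coefficients of the real and imaginary parts.  It is dominated
    by the squared norm of the fiber, and it is measurable in [m] by Fubini's theorem.  Comparisons with integrands not known to be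
    measurable go through [ge0_le_integral_lower].  Any [s] strictly between
    1/2 and 1 would do; the proof takes [s = 3/4]. *)

(** * The Fejer kernel *)

Section Fejer.
Set Implicit Arguments.
Unset Strict Implicit.
Variable R : realType.
Implicit Types (t s x : R) (n j k : nat).

Definition dirichlet n t : R := 1 + \sum_(k < n) 2 * cos (2 * pi * k.+1%:R * t).

(** The primitives of the kernels are used instead of the kernels, so that the
    Fejer mean of the indicator function of an interval is a difference of two
    values of [fejer_prim], and mean value arguments replace integrals of the
    kernel. *)
Definition dirichlet_prim n t : R :=
  t + \sum_(k < n) sin (2 * pi * k.+1%:R * t) / (pi * k.+1%:R).

Definition fejer_prim n t : R := (\sum_(j < n.+1) dirichlet_prim j t) / n.+1%:R.

Lemma sin_mul_dirichlet n t :
  sin (pi * t) * dirichlet n t = sin ((2 * n.+1%:R - 1) * (pi * t)).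
Proof.
rewrite /dirichlet; elim: n => [|n IH].
  by rewrite big_ord0 addr0 mulr1 (_ : 2 * 1 - 1 = 1) ?mul1r//; ring.
rewrite big_ord_recr/= addrA mulrDr IH.
rewrite (_ : 2 * pi * n.+1%:R * t = 2 * n.+1%:R * (pi * t)); last by ring.
rewrite mulrBl mul1r (_ : (2 * n.+2%:R - 1) * _ = 2 * n.+1%:R * (pi * t) + pi * t); last first.
  by rewrite -(natr1 n.+1); ring.
rewrite sinB sinD; ring.
Qed.

(** The telescoping identity behind the positivity of the Fejer kernel: the
    product of [sin (pi * t)] and [sin ((2 * n + 1) * pi * t)] is a difference
    of two consecutive squares. *)
Lemma sin2_mul_sum_dirichlet n t :
  sin (pi * t) ^+ 2 * \sum_(j < n) dirichlet j t = sin (n%:R * (pi * t)) ^+ 2.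
Proof.
elim: n => [|n IH]; first by rewrite big_ord0 mul0r sin0 expr0n mulr0.
rewrite big_ord_recr/= mulrDr IH expr2 -mulrA sin_mul_dirichlet.
set y := pi * t.
have -> : n%:R * y = n.+1%:R * y - y by rewrite -natr1; ring.
have -> : (2 * n.+1%:R - 1) * y = n.+1%:R * y + (n.+1%:R * y - y) by ring.
set z := n.+1%:R * y.
rewrite [sin (z + (z - y))]sinD sinB cosB.
have := cos2Dsin2 y; move: (cos z) (sin z) (cos y) (sin y) => cz sz cy sy hy.
transitivity (sz ^+ 2 * (cy ^+ 2 + sy ^+ 2)); first by ring.
by rewrite hy mulr1.
Qed.


Lemma sin_natmul_eq0 t k : sin t = 0 -> sin (k%:R * t) = 0.
Proof.
move=> t0; elim: k => [|k IH]; first by rewrite mul0r sin0.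
by rewrite -natr1 mulrDl mul1r sinD IH t0 mul0r mulr0 addr0.
Qed.

(** Where [sin (pi * t)] vanishes the identity above says nothing, but there all
    the cosines are equal to 1. *)
Lemma sum_dirichlet_ge0 n t : 0 <= \sum_(j < n) dirichlet j t.
Proof.
have [s0|s0] := eqVneq (sin (pi * t)) 0.
  apply: sumr_ge0 => j _; apply: addr_ge0 => //; apply: sumr_ge0 => k _.
  have -> : 2 * pi * k.+1%:R * t = (k.+1%:R * (pi * t)) *+ 2.
    by rewrite -[in RHS]mulr_natl; ring.
  by rewrite cos_mulr2n cos2sin2 sin_natmul_eq0// expr0n/=; lra.
have s2 : 0 < sin (pi * t) ^+ 2 by rewrite exprn_even_gt0.
by rewrite -(pmulr_rge0 _ s2) sin2_mul_sum_dirichlet sqr_ge0.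
Qed.

Lemma is_derive_dirichlet_prim n t :
  is_derive t 1 (dirichlet_prim n) (dirichlet n t).
Proof.
elim: n => [|n IH].
  have -> : dirichlet_prim 0 = id.
    by apply/funext => x; rewrite /dirichlet_prim big_ord0 addr0.
  by apply: is_derive_eq; rewrite /dirichlet big_ord0 addr0.
have -> : dirichlet_prim n.+1 = dirichlet_prim n \+
    (pi * n.+1%:R)^-1 \*: (sin \o (2 * pi * n.+1%:R \*: id)).
  apply/funext => x; rewrite /dirichlet_prim big_ord_recr/= addrA; congr (_ + _).
  by rewrite mulrC.
apply: is_derive_eq.
rewrite /dirichlet big_ord_recr/= addrA; congr (_ + _).
rewrite /GRing.scale/=; have := pi_gt0 R; move: (pi : R) => p p0.
have n0 : 1 + n%:R != 0 :> R by rewrite nat1r pnatr_eq0.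
by field; rewrite n0 gt_eqF.
Qed.

Lemma is_derive_fejer_prim n t :
  is_derive t 1 (fejer_prim n) ((\sum_(j < n.+1) dirichlet j t) / n.+1%:R).
Proof.
have -> : fejer_prim n = n.+1%:R^-1 \*: (\sum_(j < n.+1) dirichlet_prim j).
  by apply/funext => x; rewrite /fejer_prim fct_sumE/= mulrC.
rewrite mulrC; apply: is_deriveZ; apply: is_derive_sum => j.
exact: is_derive_dirichlet_prim.
Qed.

Lemma continuous_fejer_prim n : continuous (fejer_prim n).
Proof.
move=> t; apply: differentiable_continuous; apply/derivable1_diffP.
by case: (is_derive_fejer_prim n t).
Qed.

Lemma fejer_prim_le n s t : s <= t -> fejer_prim n s <= fejer_prim n t.
Proof.
move=> st; rewrite -subr_ge0.
have [] := @MVT_segment R (fejer_prim n) _ s t st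
  (fun x _ => is_derive_fejer_prim n x).
  exact/continuous_subspaceT/continuous_fejer_prim.
move=> x _ ->; apply: mulr_ge0; last by rewrite subr_ge0.
by rewrite divr_ge0// sum_dirichlet_ge0.
Qed.

Lemma sin_period_nat n t : sin (t + 2 * pi * n%:R) = sin t.
Proof.
rewrite -[RHS](periodicn (@sinD2pi R) n); congr sin.
by rewrite -[in RHS]mulr_natl -[in RHS]mulr_natl; ring.
Qed.

Lemma cos_period_nat n t : cos (t + 2 * pi * n%:R) = cos t.
Proof.
rewrite -[RHS](periodicn (@cosD2pi R) n); congr cos.
by rewrite -[in RHS]mulr_natl -[in RHS]mulr_natl; ring.
Qed.

Lemma fejer_primD1 n t : fejer_prim n (t + 1) = fejer_prim n t + 1.
Proof.
rewrite /fejer_prim.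
under eq_bigr => j _.
  rewrite (_ : dirichlet_prim j (t + 1) = dirichlet_prim j t + 1); last first.
    rewrite /dirichlet_prim addrAC; congr (_ + _ + _); apply: eq_bigr => k _.
    by rewrite mulrDr mulr1 sin_period_nat.
  over.
rewrite big_split/= sumr_const card_ord mulrDl divff//.
Qed.

(** The Fejer kernel concentrates at the integers.  Away from them it is at most
    the inverse of [n.+1 * sin (pi * t) ^+ 2], whose primitive is a cotangent,
    so [fejer_prim n] plus a multiple of the cotangent is nonincreasing. *)
Lemma fejer_prim_diff_le n s t : 0 < s -> s <= t -> t < 1 ->
  fejer_prim n t - fejer_prim n s <=
  (cos (pi * s) / sin (pi * s) - cos (pi * t) / sin (pi * t)) / pi / n.+1%:R.
Proof.
move=> s0 st t1.
have spos x : s <= x <= t -> 0 < sin (pi * x).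
  move=> /andP[sx xt]; apply: sin_gt0_pi; rewrite mulr_gt0 ?pi_gt0//=; last lra.
  by rewrite -[ltRHS]mulr1 ltr_pM2l ?pi_gt0//; lra.
pose h := fejer_prim n \+ (pi * n.+1%:R)^-1 \*:
  ((cos \o (pi \*: id)) * (fun x => ((sin \o (pi \*: id)) x)^-1)).
have dh x : s <= x <= t -> is_derive x 1 h
  ((\sum_(j < n.+1) dirichlet j x) / n.+1%:R - (sin (pi * x))^- 2 / n.+1%:R).
  move=> /spos sx.
  have sx0 : (sin \o (pi \*: id)) x != 0 by rewrite gt_eqF.
  have dF := is_derive_fejer_prim n x.
  apply: is_derive_eq.
  congr (_ + _); rewrite /GRing.scale/= /GRing.scale/=.
  have := cos2Dsin2 (pi * x); have sx1 : sin (pi * x) != 0 by rewrite gt_eqF.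
  move: (sin (pi * x)) (cos (pi * x)) sx1 => a b a0 ab.
  have n0 : 1 + n%:R != 0 :> R by rewrite nat1r pnatr_eq0.
  transitivity (- ((b ^+ 2 + a ^+ 2) * a^-2 / n.+1%:R)); last by rewrite ab mul1r.
  have := pi_gt0 R; move: (pi : R) => p p0.
  by field; rewrite n0 a0 gt_eqF.
have dho x : x \in `]s, t[ -> is_derive x 1 h
  ((\sum_(j < n.+1) dirichlet j x) / n.+1%:R - (sin (pi * x))^- 2 / n.+1%:R).
  by rewrite in_itv/= => /andP[sx xt]; apply: dh; rewrite !ltW.
have [] := MVT_segment st dho.
  by apply: derivable_within_continuous => x; rewrite in_itv/= => /dh; case.
move=> x; rewrite in_itv/= => xst E.
have : h t - h s <= 0.
  rewrite E; apply: mulr_le0_ge0; last by rewrite subr_ge0.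
  rewrite -mulrBl; apply: mulr_le0_ge0; last by [].
  have sx := spos _ xst.
  have s2 : 0 < sin (pi * x) ^+ 2 by apply: exprn_gt0.
  rewrite subr_le0 -(ler_pM2l s2) sin2_mul_sum_dirichlet divff ?gt_eqF//.
suff -> : h t - h s = fejer_prim n t - fejer_prim n s -
  (cos (pi * s) / sin (pi * s) - cos (pi * t) / sin (pi * t)) / pi / n.+1%:R.
  by rewrite subr_le0.
rewrite /h /= /GRing.scale/= invfM mulrDl.
have -> : ((cos \o *%R pi) * (fun x => (sin (pi * x))^-1)) t = cos (pi * t) / sin (pi * t) by [].
have -> : ((cos \o *%R pi) * (fun x => (sin (pi * x))^-1)) s = cos (pi * s) / sin (pi * s) by [].
by ring.
Qed.

End Fejer.

(** * Affine changes of variables *)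

Section ChangeOfVariables.
Set Implicit Arguments.
Unset Strict Implicit.
Variable R : realType.
Notation mu := (@lebesgue_measure R).

Lemma preimage_affine_itv (x k a b : R) (bl br : bool) : 0 < k ->
  (fun t => x + t * k) @^-1` [set` Interval (BSide bl (x + a * k)) (BSide br (x + b * k))]
  = [set` Interval (BSide bl a) (BSide br b)].
Proof.
move=> k0; apply/seteqP; split=> t /=; rewrite !itv_boundlr;
  by case: bl; case: br; rewrite !bnd_simp ?(lerD2l, ltrD2l, ler_pM2r, ltr_pM2r).
Qed.

Lemma measurable_affine (x k : R) :
  measurable_fun [set: measurableTypeR R] (fun t => x + t * k : measurableTypeR R).
Proof. by apply: measurable_funD => //; apply: measurable_funM. Qed.

(** By uniqueness of Lebesgue measure, it suffices to compare the two sides on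
    intervals. *)
Lemma lebesgue_measure_affine (x k : R) (k0 : 0 < k) (A : set R) :
  measurable A -> (k%:E * mu ((fun t : R => x + t * k)%R @^-1` A))%E = mu A.
Proof.
move=> mA; symmetry.
pose nu := mscale (NngNum (ltW k0))
  (pushforward mu (fun t => x + t * k : measurableTypeR R)).
rewrite -[RHS]/(nu (measurable_affine x k) A); apply: lebesgue_measure_unique => //.
move=> _ [[a b]] _ <-; rewrite /nu/= /mscale/= /pushforward/=.
have E c : x + (c - x) / k * k = c by rewrite divfK ?gt_eqF// addrC subrK.
have -> : `]a, b]%classic = [set` `](x + (a - x) / k * k), (x + (b - x) / k * k)]].
  by rewrite !E.
rewrite preimage_affine_itv// !E !lebesgue_measure_itv/= !lte_fin.
rewrite ltr_pM2r ?invr_gt0// ltrD2r; case: ifP => _; last by rewrite mule0.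
by rewrite -!EFinD -EFinM; congr _%:E; field; rewrite gt_eqF.
Qed.

Lemma ge0_integral_affine (x k : R) (D : set R) (f : R -> \bar R) : 0 < k ->
  measurable D -> measurable_fun setT f -> (forall y, (0 <= f y)%E) ->
  (k%:E * \int[mu]_(t in (fun t : R => x + t * k)%R @^-1` D) f (x + t * k)%R =
   \int[mu]_(y in D) f y)%E.
Proof.
move=> k0 mD mf f0.
have mfD : measurable_fun D f by exact: measurable_funTS.
rewrite -[X in (_ * X)%E](@ge0_integral_pushforward _ _ _ _ _ _ (measurable_affine x k) mu D f)//.
rewrite -[X in (X%:E * _)%E]/((NngNum (ltW k0))%:num) -ge0_integral_mscale//=.
  exact: measurable_affine.
move=> mf1; apply: eq_measure_integral => A mA _.
by rewrite -[RHS](lebesgue_measure_affine x k0 mA).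
Qed.

Lemma Rintegral_affine (x k a b : R) (f : R -> R) : 0 < k ->
  measurable_fun setT f ->
  mu.-integrable `[x + a * k, x + b * k] (EFin \o f) ->
  k * \int[mu]_(t in `[a, b]) f (x + t * k) =
  \int[mu]_(y in `[x + a * k, x + b * k]) f y.
Proof.
move=> k0 mf fi; rewrite /Rintegral.
set D := (`[_, _]%classic : set R) in fi *.
have mD : measurable D by exact: measurable_itv.
have mF : measurable_fun setT (EFin \o f) by exact/measurable_EFinP.
have pf : (\int[mu]_(y in D) (EFin \o f)^\+ y)%E \is a fin_num.
  exact/integrable_fin_num/integrable_funepos.
have nf : (\int[mu]_(y in D) (EFin \o f)^\- y)%E \is a fin_num.
  exact/integrable_fin_num/integrable_funeneg.
have mFp := measurable_funepos mF; have mFn := measurable_funeneg mF.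
have DE : (fun t : R => x + t * k) @^-1` D = `[a, b]%classic.
  exact: preimage_affine_itv.
rewrite (_ : \int[mu]_(y in D) _ = \int[mu]_(y in D) (EFin \o f) y)%E//.
rewrite [X in _ = fine X]integralE.
have Ep := ge0_integral_affine x k0 mD mFp (funepos_ge0 (EFin \o f)).
have En := ge0_integral_affine x k0 mD mFn (funeneg_ge0 (EFin \o f)).
rewrite DE in Ep En; rewrite -Ep in pf *; rewrite -En in nf *.
have fin r (X : \bar R) : 0 < r -> (r%:E * X)%E \is a fin_num -> X \is a fin_num.
  by move=> r0; case: X => //=; rewrite (gt0_muley, gt0_muleNy) ?lte_fin.
have {}pf := fin _ _ k0 pf; have {}nf := fin _ _ k0 nf.
set A := (\int[mu]_(t in `[a, b]) (EFin \o f)^\+ (x + t * k)%R)%E in pf *.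
set B := (\int[mu]_(t in `[a, b]) (EFin \o f)^\- (x + t * k)%R)%E in nf *.
have -> : (\int[mu]_(t in `[a, b]) (f (x + t * k)%R)%:E = A - B)%E.
  rewrite integralE; congr (_ - _)%E; apply: eq_integral => t _.
    by rewrite !funeposE.
  by rewrite !funenegE.
clearbody A B; by rewrite !fineB ?fin_numM// !fineM//= mulrBr.
Qed.


End ChangeOfVariables.

(** * Integrals of periodic functions *)

Section Integrability.
Set Implicit Arguments.
Unset Strict Implicit.
Variable R : realType.
Notation mu := (@lebesgue_measure R).

Lemma integrable_mul_bounded (D : set R) (u h : R -> R) (M : R) :
  measurable D -> mu.-integrable D (EFin \o u) -> measurable_fun D h ->
  (forall x, D x -> `|h x| <= M) ->
  mu.-integrable D (EFin \o (fun x => u x * h x)).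
Proof.
move=> mD ui mh hM.
have M1 x : D x -> `|h x| <= `|M| by move=> Dx; rewrite (le_trans (hM x Dx))// ler_norm.
apply: (@le_integrable _ _ _ mu D mD _ (fun x => `|M|%:E * (EFin \o u) x)%E).
- apply/measurable_EFinP; apply: measurable_funM => //.
  by apply/measurable_EFinP; case/integrableP: ui.
- move=> x Dx; rewrite /= lee_fin !normrM normr_id mulrC.
  by rewrite ler_wpM2r// M1.
- exact: integrableZl.
Qed.

Lemma integrable_disjoint_setU (A B : set R) (f : R -> \bar R) :
  measurable A -> measurable B -> measurable_fun setT f -> [disjoint A & B] ->
  mu.-integrable A f -> mu.-integrable B f -> mu.-integrable (A `|` B) f.
Proof.
move=> mA mB mf AB /integrableP[_ fA] /integrableP[_ fB].
apply/integrableP; split; first exact: measurable_funTS.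
rewrite ge0_integral_setU//; last by do 2 apply: measurableT_comp => //.
exact: lte_add_pinfty.
Qed.

Definition one_periodic (u : R -> R) := forall x, u (x + 1) = u x.

Lemma periodic_nat (u : R -> R) : one_periodic u ->
  forall (n : nat) x, u (x + n%:R) = u x.
Proof.
move=> pu; elim=> [|n IH] x; first by rewrite addr0.
by rewrite -natr1 addrA pu IH.
Qed.

Lemma periodic_int (u : R -> R) : one_periodic u ->
  forall (n : int) x, u (x + n%:~R) = u x.
Proof.
move=> pu [] n x; first exact: (periodic_nat pu).
by rewrite -[in RHS](subrK n.+1%:R x) (periodic_nat pu) NegzE mulrNz.
Qed.

Lemma Rintegral_translate (u : R -> R) (c a b : R) : measurable_fun setT u ->
  mu.-integrable `[c + a, c + b] (EFin \o u) ->
  \int[mu]_(t in `[a, b]) u (c + t) = \int[mu]_(y in `[c + a, c + b]) u y.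
Proof.
move=> m_u ui; have := @Rintegral_affine R c 1 a b u ltr01 m_u.
rewrite !mulr1 => /(_ ui) <-; rewrite mul1r.
by apply: eq_Rintegral => t _; rewrite mulr1.
Qed.

Lemma Rintegral_itv_cat (u : R -> R) (a b c : R) : a <= b -> b <= c ->
  mu.-integrable `[a, c] (EFin \o u) ->
  \int[mu]_(x in `[a, c]) u x =
  \int[mu]_(x in `[a, b]) u x + \int[mu]_(x in `[b, c]) u x.
Proof.
move=> ab bc ui; apply/eqP; rewrite addrC -subr_eq; apply/eqP.
rewrite Rintegral_itvB ?bnd_simp// Rintegral_itv_obnd_cbnd//.
by apply: integrableS ui => //; apply: subset_itvr; rewrite bnd_simp.
Qed.

Lemma integrable_periodic (u : R -> R) : measurable_fun setT u ->
  one_periodic u -> mu.-integrable `[0, 1] (EFin \o u) ->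
  forall a b, mu.-integrable `[a, b] (EFin \o u).
Proof.
move=> m_u pu ui a b.
have mU : measurable_fun setT (EFin \o u) by exact/measurable_EFinP.
have cell (z : int) : mu.-integrable `[z%:~R, z%:~R + 1] (EFin \o u).
  case/integrableP: ui => _ ui.
  apply/integrableP; split; first exact: measurable_funTS.
  apply: le_lt_trans ui.
  pose D := `[z%:~R, z%:~R + 1 : R]%classic.
  have := @ge0_integral_affine R z%:~R 1 D (abse \o (EFin \o u)) ltr01.
  rewrite -/D => <- //; last 3 first.
  - exact: measurable_itv.
  - by apply: measurableT_comp.
  - by move=> y; exact: abse_ge0.
  have -> : D = `[z%:~R + 0 * 1, z%:~R + 1 * 1]%classic.
    by rewrite /D mul0r addr0 mulr1.
  rewrite preimage_affine_itv// mul1e.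
  under eq_integral => t _.
    rewrite /= mulr1 addrC periodic_int//; over.
  by [].
have cells (z : int) (k : nat) :
    mu.-integrable `[z%:~R, z%:~R + k%:R] (EFin \o u).
  elim: k => [|k IH].
    by apply: integrableS (cell z) => //; apply: subset_itvl; rewrite bnd_simp lerD2l.
  rewrite (@itv_bndbnd_setU _ _ _ (BRight (z%:~R + k%:R))) ?bnd_simp//; last 2 first.
    by rewrite lerDl.
    by rewrite lerD2l ler_nat.
  apply: integrable_disjoint_setU => //.
    apply/disj_setPS => y [/=]; rewrite 2!in_itv/= => /andP[_ yx] /andP[].
    by rewrite ltNge yx.
  have := cell (z + k%:Z)%R; rewrite intrD -[k%:Z%:~R]/(k%:R) -addrA natr1.
  by apply: integrableS => //; apply: subset_itvr; rewrite bnd_simp.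
have [k bk] : exists k : nat, b <= (Num.floor a)%:~R + k%:R.
  exists (Num.bound `|b - (Num.floor a)%:~R|).
  by rewrite -lerBlDl ltW// (le_lt_trans (ler_norm _))// archi_boundP.
apply: integrableS (cells (Num.floor a) k) => //.
by apply: subset_itv; rewrite bnd_simp//; exact: Num.Theory.floor_le.
Qed.

Lemma Rintegral_period (u : R -> R) : measurable_fun setT u ->
  one_periodic u -> mu.-integrable `[0, 1] (EFin \o u) ->
  forall a, \int[mu]_(x in `[a, a + 1]) u x = \int[mu]_(x in `[0, 1]) u x.
Proof.
move=> m_u pu ui a.
have ui' := @integrable_periodic u m_u pu ui.
set n := Num.floor a; pose r := a - n%:~R.
have r0 : 0 <= r by rewrite subr_ge0 Num.Theory.floor_le.
have r1 : r <= 1.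
  by rewrite lerBlDr addrC ltW// -[1]/(1%:~R) -intrD Num.Theory.floorD1_gt.
have -> : a = n%:~R + r by rewrite addrC subrK.
have shift (z : int) x y : \int[mu]_(t in `[z%:~R + x, z%:~R + y]) u t =
    \int[mu]_(t in `[x, y]) u t.
  rewrite -Rintegral_translate//; apply: eq_Rintegral => t _.
  by rewrite addrC periodic_int.
rewrite -addrA shift (@Rintegral_itv_cat u r 1 (r + 1))// ?lerDr//.
rewrite (@Rintegral_itv_cat u 0 r 1)// addrC; congr (_ + _).
by have := shift 1 0 r; rewrite addr0 [X in `[_, X]]addrC.
Qed.

End Integrability.

(** * Testing a periodic function against Dirichlet and Fejer means *)

Section FourierTest.
Set Implicit Arguments.
Unset Strict Implicit.
Variable R : realType.
Notation mu := (@lebesgue_measure R).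

Lemma norm_cosB_le (x y : R) : `|cos x - cos y| <= `|x - y|.
Proof.
wlog xy : x y / x <= y => [H|].
  by case: (leP x y) => [/H//|/ltW/H]; rewrite distrC [leRHS]distrC.
have [] := @MVT_segment R cos (fun t => - sin t) x y xy (fun t _ => is_derive_cos t).
  exact/continuous_subspaceT/continuous_cos.
move=> t _; rewrite distrC => ->; rewrite normrM normrN [leRHS]distrC.
by rewrite ler_piMl// sin_max.
Qed.

Lemma norm_sinB_le (x y : R) : `|sin x - sin y| <= `|x - y|.
Proof.
wlog xy : x y / x <= y => [H|].
  by case: (leP x y) => [/H//|/ltW/H]; rewrite distrC [leRHS]distrC.
have [] := @MVT_segment R sin cos x y xy (fun t _ => is_derive_sin t).
  exact/continuous_subspaceT/continuous_sin.
move=> t _; rewrite distrC => ->; rewrite normrM [leRHS]distrC.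
by rewrite ler_piMl// cos_max.
Qed.

Definition cos_coef (u : R -> R) (k : nat) : R :=
  \int[mu]_(x in `[0, 1]) (u x * cos (2 * pi * k%:R * x)).

Definition sin_coef (u : R -> R) (k : nat) : R :=
  \int[mu]_(x in `[0, 1]) (u x * sin (2 * pi * k%:R * x)).

Lemma measurable_cos_freq (k : nat) (D : set R) :
  measurable_fun D (fun x : R => cos (2 * pi * k%:R * x)).
Proof.
apply: measurable_funTS; apply: continuous_measurable_fun => x.
apply: continuous_comp; last exact: continuous_cos.
by apply: cvgM; [exact: cvg_cst|exact: cvg_id].
Qed.

Lemma measurable_sin_freq (k : nat) (D : set R) :
  measurable_fun D (fun x : R => sin (2 * pi * k%:R * x)).
Proof.
apply: measurable_funTS; apply: continuous_measurable_fun => x.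
apply: continuous_comp; last exact: continuous_sin.
by apply: cvgM; [exact: cvg_cst|exact: cvg_id].
Qed.

Lemma integrableZl_real (D : set R) (r : R) (f : R -> R) : measurable D ->
  mu.-integrable D (EFin \o f) -> mu.-integrable D (EFin \o (fun x => r * f x)).
Proof.
move=> mD fi.
by rewrite (_ : _ \o _ = (fun x => r%:E * (EFin \o f) x)%E); [exact: integrableZl|].
Qed.

Lemma integrableD_real (D : set R) (f g : R -> R) : measurable D ->
  mu.-integrable D (EFin \o f) -> mu.-integrable D (EFin \o g) ->
  mu.-integrable D (EFin \o (fun x => f x + g x)).
Proof.
move=> mD fi gi.
by rewrite (_ : _ \o _ = ((EFin \o f) \+ (EFin \o g))%E); [exact: integrableD|].
Qed.

Lemma integrable_mul_cos (D : set R) (w : R -> R) (k : nat) : measurable D ->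
  mu.-integrable D (EFin \o w) ->
  mu.-integrable D (EFin \o (fun x => w x * cos (2 * pi * k%:R * x))).
Proof.
move=> mD wi; apply: (@integrable_mul_bounded _ _ _ _ 1) => //.
  exact: measurable_cos_freq.
by move=> x _; exact: cos_max.
Qed.

Lemma integrable_mul_sin (D : set R) (w : R -> R) (k : nat) : measurable D ->
  mu.-integrable D (EFin \o w) ->
  mu.-integrable D (EFin \o (fun x => w x * sin (2 * pi * k%:R * x))).
Proof.
move=> mD wi; apply: (@integrable_mul_bounded _ _ _ _ 1) => //.
  exact: measurable_sin_freq.
by move=> x _; exact: sin_max.
Qed.

Section PeriodicMeanZero.
Variable u : R -> R.
Hypotheses (m_u : measurable_fun setT u) (pu : one_periodic u)
  (ui : mu.-integrable `[0, 1] (EFin \o u)).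

Let uab := integrable_periodic m_u pu ui.

Let integrable_cos_freq k (a b : R) :=
  integrable_mul_cos k (measurable_itv _) (uab a b).

Let integrable_sin_freq k (a b : R) :=
  integrable_mul_sin k (measurable_itv _) (uab a b).

Lemma cos_coef_period k (a : R) :
  \int[mu]_(x in `[a, a + 1]) (u x * cos (2 * pi * k%:R * x)) = cos_coef u k.
Proof.
apply: (@Rintegral_period _ (fun x => u x * cos (2 * pi * k%:R * x))).
- by apply: measurable_funM => //; exact: measurable_cos_freq.
- by move=> x; rewrite pu mulrDr mulr1 cos_period_nat.
- exact: integrable_cos_freq.
Qed.

Lemma sin_coef_period k (a : R) :
  \int[mu]_(x in `[a, a + 1]) (u x * sin (2 * pi * k%:R * x)) = sin_coef u k.
Proof.
apply: (@Rintegral_period _ (fun x => u x * sin (2 * pi * k%:R * x))).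
- by apply: measurable_funM => //; exact: measurable_sin_freq.
- by move=> x; rewrite pu mulrDr mulr1 sin_period_nat.
- exact: integrable_sin_freq.
Qed.

Hypothesis u0 : \int[mu]_(x in `[0, 1]) u x = 0.

Let G (n : nat) (a b x : R) := dirichlet_prim n (x - a) - dirichlet_prim n (x - b).

Let GS n a b x : let w := 2 * pi * n.+1%:R in
  G n.+1 a b x = G n a b x +
    ((cos (w * a) - cos (w * b)) / (pi * n.+1%:R) * sin (w * x) +
     (sin (w * b) - sin (w * a)) / (pi * n.+1%:R) * cos (w * x)).
Proof.
rewrite /G /dirichlet_prim !big_ord_recr/= !mulrBr !sinB.
by ring.
Qed.

(** For [b <= a + 1], [G n a b] is the [n]-th Fourier partial sum of the
    periodized indicator function of [`[a, b]].  Its coefficients are bounded by [2 * (b - a)], since sine and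
    cosine are Lipschitz; this is what makes the final estimate proportional to
    the length of the interval. *)
Lemma dirichlet_test_bound n (a b : R) : a <= b ->
  mu.-integrable `[a, a + 1] (EFin \o (fun x => u x * G n a b x)) /\
  `|\int[mu]_(x in `[a, a + 1]) (u x * G n a b x)| <=
    2 * (b - a) * \sum_(k < n) (`|cos_coef u k.+1| + `|sin_coef u k.+1|).
Proof.
move=> ab; elim: n => [|n [IHi IH]].
  have G0 x : u x * G 0 a b x = (b - a) * u x.
    by rewrite /G /dirichlet_prim !big_ord0; ring.
  have -> : (fun x => u x * G 0 a b x) = (fun x => (b - a) * u x) by exact/funext.
  split; first by apply: integrableZl_real.
  rewrite RintegralZl// Rintegral_period// u0 mulr0 normr0.
  by rewrite big_ord0 mulr0.
pose w : R := 2 * pi * n.+1%:R.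
pose A : R := (cos (w * a) - cos (w * b)) / (pi * n.+1%:R).
pose B : R := (sin (w * b) - sin (w * a)) / (pi * n.+1%:R).
have p0 : 0 < pi * n.+1%:R :> R by rewrite mulr_gt0 ?pi_gt0.
have wE : w = 2 * (pi * n.+1%:R) by rewrite /w mulrA.
have wn : `|w| * `|b - a| = 2 * (b - a) * (pi * n.+1%:R).
  by rewrite wE (ger0_norm (x := b - a)) ?subr_ge0// normrM (gtr0_norm p0) normr_nat mulrAC.
have A2 : `|A| <= 2 * (b - a).
  rewrite normrM normfV (gtr0_norm p0) ler_pdivrMr//.
  by rewrite (le_trans (norm_cosB_le _ _))// -mulrBr normrM distrC wn.
have B2 : `|B| <= 2 * (b - a).
  rewrite normrM normfV (gtr0_norm p0) ler_pdivrMr//.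
  by rewrite (le_trans (norm_sinB_le _ _))// -mulrBr normrM wn.
have GE x : u x * G n.+1 a b x = u x * G n a b x +
    (A * (u x * sin (w * x)) + B * (u x * cos (w * x))).
  by rewrite GS; rewrite -/w -/A -/B; ring.
have -> : (fun x => u x * G n.+1 a b x) = (fun x => u x * G n a b x +
    (A * (u x * sin (w * x)) + B * (u x * cos (w * x)))) by exact/funext.
have iA := integrableZl_real A (measurable_itv _) (integrable_sin_freq n.+1 a (a + 1)).
have iB := integrableZl_real B (measurable_itv _) (integrable_cos_freq n.+1 a (a + 1)).
have iAB := integrableD_real (measurable_itv _) iA iB.
split; first exact: (integrableD_real (measurable_itv _) IHi iAB).
rewrite RintegralD// RintegralD//.
rewrite RintegralZl//; last exact: integrable_sin_freq.
rewrite RintegralZl//; last exact: integrable_cos_freq.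
rewrite cos_coef_period sin_coef_period big_ord_recr/= mulrDr.
rewrite (le_trans (ler_normD _ _))// lerD//.
rewrite (le_trans (ler_normD _ _))// addrC mulrDr (normrM A) (normrM B).
by rewrite lerD// ler_wpM2r.
Qed.

End PeriodicMeanZero.
End FourierTest.

(** * Integrals over intervals and the sum of the Fourier coefficients *)

Section FourierSup.
Set Implicit Arguments.
Unset Strict Implicit.
Variable R : realType.
Notation mu := (@lebesgue_measure R).
Variables (u : R -> R) (S : R).
Hypotheses (m_u : measurable_fun setT u) (pu : one_periodic u)
  (ui : mu.-integrable `[0, 1] (EFin \o u))
  (u0 : \int[mu]_(x in `[0, 1]) u x = 0)
  (uS : forall n, \sum_(k < n) (`|cos_coef u k.+1| + `|sin_coef u k.+1|) <= S).

Let p n (a b x : R) := fejer_prim n (x - a) - fejer_prim n (x - b).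

(** The Dirichlet bound does not depend on the order of the partial sum, hence it
    is inherited by the Cesaro means. *)
Lemma fejer_test_bound n (a b : R) : a <= b ->
  mu.-integrable `[a, a + 1] (EFin \o (fun x => u x * p n a b x)) /\
  `|\int[mu]_(x in `[a, a + 1]) (u x * p n a b x)| <= 2 * (b - a) * S.
Proof.
move=> ab.
pose G j x : R := dirichlet_prim j (x - a) - dirichlet_prim j (x - b).
have HG j : mu.-integrable `[a, a + 1] (EFin \o (fun x => u x * G j x)) /\
  `|\int[mu]_(x in `[a, a + 1]) (u x * G j x)| <= 2 * (b - a) * S.
  have [iG G2] := dirichlet_test_bound m_u pu ui u0 j ab; split=> //.
  by rewrite (le_trans G2)// ler_wpM2l// mulr_ge0// subr_ge0.
have HS m : mu.-integrable `[a, a + 1]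
      (EFin \o (fun x => \sum_(j < m) (u x * G j x))) /\
  `|\int[mu]_(x in `[a, a + 1]) (\sum_(j < m) (u x * G j x))| <=
    m%:R * (2 * (b - a) * S).
  elim: m => [|m [IHi IH]].
    have -> : (fun x => \sum_(j < 0) (u x * G j x)) = cst 0.
      by apply/funext => x; rewrite big_ord0.
    by split; [exact: integrable0|rewrite /Rintegral integral0 normr0 mul0r].
  have [iG G2] := HG m.
  have -> : (fun x => \sum_(j < m.+1) (u x * G j x)) =
      (fun x => \sum_(j < m) (u x * G j x) + u x * G m x).
    by apply/funext => x; rewrite big_ord_recr.
  split; first exact: integrableD_real.
  rewrite RintegralD// (le_trans (ler_normD _ _))// -natr1 mulrDl mul1r.
  exact: lerD.
have [iS S2] := HS n.+1.
have pE : (fun x => u x * p n a b x) =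
    (fun x => n.+1%:R^-1 * \sum_(j < n.+1) (u x * G j x)).
  apply/funext => x; rewrite /p /fejer_prim -mulrBl -sumrB -mulr_sumr.
  by rewrite mulrA mulrC.
rewrite pE; split; first exact: integrableZl_real.
rewrite RintegralZl// normrM normfV normr_nat mulrC ler_pdivrMr//.
by rewrite mulrC.
Qed.

Lemma fejer_test_itv01 n (a b x : R) : a <= b -> b <= a + 1 -> 0 <= p n a b x <= 1.
Proof.
move=> ab ba; rewrite subr_ge0 lerBlDl -fejer_primD1.
by rewrite !fejer_prim_le//; lra.
Qed.

Lemma fejer_test_near_indic (a b x : R) : a <= b -> b <= a + 1 ->
  a < x -> x < a + 1 -> x != b ->
  exists K : R, forall n, `|p n a b x - \1_`[a, b] x| <= K / n.+1%:R.
Proof.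
move=> ab ba ax xa xb.
pose K (s t : R) := (cos (pi * s) / sin (pi * s) - cos (pi * t) / sin (pi * t)) / pi.
case: (ltP x b) => [{}xb|bx].
  exists (K (x - a) (x - b + 1)) => n.
  rewrite indicE mem_set/=; last by rewrite in_itv/= !ltW.
  rewrite distrC.
  have := fejer_test_itv01 n x ab ba => /andP[_ p1].
  rewrite ger0_norm ?subr_ge0//.
  have -> : 1 - p n a b x = fejer_prim n (x - b + 1) - fejer_prim n (x - a).
    by rewrite fejer_primD1 /p; ring.
  by apply: fejer_prim_diff_le; lra.
have {xb}bx : b < x by rewrite lt_neqAle eq_sym xb.
exists (K (x - b) (x - a)) => n.
rewrite indicE memNset/=; last by rewrite in_itv/= => /andP[_]; rewrite leNgt bx.
rewrite subr0 ger0_norm; last by case/andP: (fejer_test_itv01 n x ab ba).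
by apply: fejer_prim_diff_le; lra.
Qed.

(** The Fejer means of the indicator function of [`[a, b]] stay between 0 and 1
    and converge to it except at [a], [b] and [a + 1], so dominated convergence
    passes to the limit in [fejer_test_bound].  This replaces the completeness
    of the trigonometric system. *)
Lemma Rintegral_short_le (a b : R) : a <= b -> b <= a + 1 ->
  `|\int[mu]_(x in `[a, b]) u x| <= 2 * (b - a) * S.
Proof.
move=> ab ba.
pose D := (`[a, a + 1]%classic : set R).
have mD : measurable D by exact: measurable_itv.
have uD : mu.-integrable D (EFin \o u) by exact: integrable_periodic.
pose f_ n x := (u x * p n a b x)%:E.
pose f x := (u x * \1_`[a, b] x)%:E.
have mf : measurable_fun D f.
  apply/measurable_EFinP/measurable_funTS; exact: measurable_funM.
have mf_ n : measurable_fun D (f_ n).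
  by case: (fejer_test_bound n ab) => /integrableP[].
have uN : mu.-integrable D (fun x => `|u x|%:E) by exact: integrable_norm.
have [] := @dominated_convergence _ _ _ mu D mD f_ f _ mf_ mf _ uN.
- pose N : set R := [set a] `|` [set b] `|` [set a + 1].
  exists N; split.
  + by do 2 apply: measurableU => //.
  + apply: countable_lebesgue_measure0; apply: finite_set_countable.
    by rewrite !finite_setU; do !split; exact: finite_set1.
  + move=> x /= xN; apply: contrapT => /not_orP[/not_orP[xa xb] xa1]; apply: xN.
    rewrite /D/= in_itv/= => /andP[ax xa1'].
    have {}ax : a < x by rewrite lt_neqAle ax andbT eq_sym; exact/eqP.
    have {xa1'}xa1 : x < a + 1 by rewrite lt_neqAle xa1' andbT; exact/eqP.
    have [K HK] := fejer_test_near_indic ab ba ax xa1 (introN eqP xb).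
    apply: cvg_EFin; first exact: nearW.
    apply: cvgM; first exact: cvg_cst.
    apply/subr_cvg0/norm_cvg0P.
    apply: (@squeeze_cvgr _ _ _ _ (cst 0) (fun n => K * harmonic n)).
    * by apply: nearW => n; rewrite normr_ge0/= HK.
    * exact: cvg_cst.
    * by rewrite -(mulr0 K); apply: cvgMr; exact: cvg_harmonic.
- apply: aeW => x n Dx; rewrite lee_fin normrM ler_piMr//.
  have /andP[p0 p1] := fejer_test_itv01 n x ab ba.
  by rewrite ger0_norm.
move=> _ _ cvf.
have fE : (\int[mu]_(x in D) f x = (\int[mu]_(x in `[a, b]) u x)%:E)%E.
  have abD : `[a, b] `<=` D by apply: subset_itvl; rewrite bnd_simp.
  rewrite /Rintegral fineK; last first.
    by apply: integrable_fin_num => //; exact: integrableS uD.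
  rewrite -[in RHS](setIidr abD) integral_mkcondr; apply: eq_integral => x _.
  by rewrite patchE /f indicE; case: ifP => _; rewrite ?mulr1 ?mulr0.
have fnE n : (\int[mu]_(x in D) f_ n x)%E = (\int[mu]_(x in D) (u x * p n a b x))%:E.
  by rewrite /Rintegral fineK//; apply: integrable_fin_num => //;
   case: (fejer_test_bound n ab).
rewrite fE in cvf.
have : (\int[mu]_(x in D) f_ n x)%E @[n --> \oo] --> (\int[mu]_(x in `[a, b]) u x)%:E.
  exact: cvf.
under eq_cvg do rewrite fnE.
move=> /fine_cvgP[_] cvr.
have cvn : `|\int[mu]_(x in D) (u x * p n a b x)| @[n --> \oo] -->
    `|\int[mu]_(x in `[a, b]) u x| by exact: cvg_norm.
rewrite -(cvg_lim _ cvn)//.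
apply: limr_le; first exact: cvgP cvn.
apply: nearW => n /=.
by case: (fejer_test_bound n ab).
Qed.

End FourierSup.

(** * Time averages of a real periodic function *)

Section TimeAverage.
Set Implicit Arguments.
Unset Strict Implicit.
Variable R : realType.
Notation mu := (@lebesgue_measure R).

Lemma sum_invsq_le2 (n : nat) : \sum_(k < n) (k.+1%:R ^+ 2)^-1 <= 2 :> R.
Proof.
case: n => [|n]; first by rewrite big_ord0.
suff: \sum_(k < n.+1) (k.+1%:R ^+ 2)^-1 <= 2 - n.+1%:R^-1 :> R.
  by move=> /le_trans; apply; rewrite lerBlDr lerDl.
elim: n => [|n IH]; first by rewrite big_ord_recr big_ord0/=; lra.
rewrite big_ord_recr/= (le_trans (lerD IH (lexx _)))//.
rewrite -[n.+2%:R]natr1; have : 0 < n.+1%:R :> R by [].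
move: (n.+1%:R : R) => x x0.
have x1 : 0 < x + 1 by lra.
rewrite -subr_ge0 (_ : _ - _ = (x * (x + 1) ^+ 2)^-1); last first.
  by field; rewrite !gt_eqF.
by rewrite invr_ge0 mulr_ge0 ?sqr_ge0 ?ltW.
Qed.

(** A form of the Cauchy-Schwarz inequality.  Applying the arithmetic-geometric
    mean inequality to each [`|a k| * s], where [s] is the whole sum, gives
    [s ^+ 2 <= 2 * X + s ^+ 2 / 2]; the last term can be absorbed. *)
Lemma sum_norm_sq_le (a b : nat -> R) (n : nat) (X : R) :
  \sum_(k < n) k.+1%:R ^+ 2 * (a k.+1 ^+ 2 + b k.+1 ^+ 2) <= X ->
  (\sum_(k < n) (`|a k.+1| + `|b k.+1|)) ^+ 2 <= 4 * X.
Proof.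
move=> HX; set s := \sum_(k < n) (`|_| + `|_|).
(* With [w = k ^ 2], and since the inverse squares add up to at most 2, the
   denominator 8 leaves half of [s ^+ 2] after summation over [a] and [b]. *)
have amgm (w c : R) : 0 < w -> `|c| * s <= 2 * (w * c ^+ 2) + s ^+ 2 / 8 * w^-1.
  move=> w0; rewrite -subr_ge0 -[c ^+ 2]real_normK ?num_real//.
  have -> : 2 * (w * `|c| ^+ 2) + s ^+ 2 / 8 * w^-1 - `|c| * s =
      2 * w * (`|c| - s / (4 * w)) ^+ 2.
    by field; rewrite gt_eqF.
  by rewrite mulr_ge0 ?sqr_ge0 // mulr_ge0 // ltW.
have: s ^+ 2 <= 2 * X + s ^+ 2 / 4 * 2.
  rewrite [X in X <= _]expr2 {1}/s mulr_suml.
  apply: (@le_trans _ _ (\sum_(k < n) (2 * (k.+1%:R ^+ 2 * (a k.+1 ^+ 2 + b k.+1 ^+ 2))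
     + s ^+ 2 / 4 * (k.+1%:R ^+ 2)^-1))).
    apply: ler_sum => k _; have k0 : 0 < k.+1%:R ^+ 2 :> R by exact: exprn_gt0.
    have := lerD (amgm _ (a k.+1) k0) (amgm _ (b k.+1) k0).
    rewrite -mulrDl => /le_trans; apply.
    by rewrite le_eqVlt; apply/orP; left; apply/eqP; field; rewrite gt_eqF.
  rewrite big_split/= -!mulr_sumr lerD// ?ler_wpM2l// ?divr_ge0 ?sqr_ge0//.
  exact: sum_invsq_le2.
lra.
Qed.

Lemma min1_inv_sq_le (z l : R) : 0 < z -> 0 <= l -> l <= 2 ->
  Num.min 1 z^-1 ^+ 2 <= z `^ (- l).
Proof.
move=> z0 l0 l2.
have m0 : 0 <= Num.min 1 z^-1 by rewrite le_min ler01 invr_ge0 ltW.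
case: (leP 1 z) => z1.
  rewrite (le_trans (y := z `^ (- 2)))//; last by rewrite ler_powR// lerN2.
  rewrite powRN -[2]/(2%:R) powR_mulrn ?(ltW z0)// -exprVn.
  rewrite ler_sqr ?nnegrE//; last by rewrite invr_ge0 ltW.
  by rewrite ge_min lexx orbT.
rewrite (le_trans (y := 1))//.
  by rewrite exprn_ile1// ge_min lexx.
rewrite powRN invf_ge1 ?powR_gt0//.
have := @ge0_ler_powR R l l0 z 1; rewrite powR1 !nnegrE.
by apply; rewrite ?ltW.
Qed.

Section Periodic.
Variables (u : R -> R) (X : R).
Hypotheses (m_u : measurable_fun setT u) (pu : one_periodic u)
  (ui : mu.-integrable `[0, 1] (EFin \o u))
  (u0 : \int[mu]_(x in `[0, 1]) u x = 0)
  (uX : forall n, \sum_(k < n) k.+1%:R ^+ 2 *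
     (cos_coef u k.+1 ^+ 2 + sin_coef u k.+1 ^+ 2) <= X).

Let X0 : 0 <= X.
Proof. by have := uX 0; rewrite big_ord0. Qed.

Let S := 2 * Num.sqrt X.

Let uS n : \sum_(k < n) (`|cos_coef u k.+1| + `|sin_coef u k.+1|) <= S.
Proof.
have s0 : 0 <= S by rewrite mulr_ge0// sqrtr_ge0.
rewrite -ler_sqr ?nnegrE//; last by apply: sumr_ge0 => k _; exact: addr_ge0.
rewrite (le_trans (sum_norm_sq_le (uX n)))// exprMn sqr_sqrtr//.
by rewrite -natrX.
Qed.

(** Over a whole period the integral is zero, so only the length of the interval
    modulo 1 counts. *)
Lemma Rintegral_long_le (a b : R) : a <= b ->
  `|\int[mu]_(x in `[a, b]) u x| <= 2 * S * Num.min (b - a) 1.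
Proof.
move=> ab; have s0 : 0 <= 2 * S by rewrite !mulr_ge0// sqrtr_ge0.
have uab := integrable_periodic m_u pu ui.
have [n] : exists n : nat, b <= a + n.+1%:R.
  exists (Num.bound `|b - a|); rewrite -lerBlDl (le_trans (ler_norm _))//.
  by rewrite ltW// (lt_trans (archi_boundP _))// ltr_nat.
elim: n a ab => [|n IH] a ab ban.
  rewrite min_l ?lerBlDl// mulrAC.
  exact: Rintegral_short_le.
have [ba|ba] := leP b (a + 1).
  by rewrite min_l ?lerBlDl// mulrAC; exact: Rintegral_short_le.
have a1 : a <= a + 1 by rewrite lerDl.
rewrite (Rintegral_itv_cat a1 (ltW ba) (uab _ _)).
rewrite Rintegral_period// u0 add0r.
rewrite (le_trans (IH _ (ltW ba) _))//; first by rewrite -addrA nat1r.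
rewrite ler_wpM2l// le_min !ge_min lexx orbT andbT.
by apply/orP; left; lra.
Qed.

(** The substitution [y = x + t * w] turns the time average into the mean over an
    interval of length [z = 2 * T * w], and [Num.min z 1] divided by [z] is
    [Num.min 1 z^-1]. *)
Lemma time_average_sq_le (x w T l : R) : 0 < w -> 0 < T -> 0 <= l -> l <= 2 ->
  ((2 * T)^-1 * \int[mu]_(t in `[- T, T]) u (x + t * w)) ^+ 2 <=
  16 * X * (2 * T * w) `^ (- l).
Proof.
move=> w0 T0 l0 l2; pose z := 2 * T * w.
have z0 : 0 < z by rewrite !mulr_gt0.
set I := \int[mu]_(t in _) _.
have : `|w * I| <= 2 * S * Num.min z 1.
  rewrite /I Rintegral_affine//; last exact: integrable_periodic.
  have xx : x + - T * w <= x + T * w by rewrite lerD2l ler_pM2r//; lra.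
  rewrite (le_trans (Rintegral_long_le xx))//.
  by rewrite (_ : _ - _ = z)// /z; ring.
rewrite normrM (gtr0_norm w0) => HI.
have : `|(2 * T)^-1 * I| <= 2 * S * Num.min 1 z^-1.
  have T2 : 0 < 2 * T by rewrite mulr_gt0.
  rewrite normrM gtr0_norm ?invr_gt0//.
  have -> : (2 * T)^-1 * `|I| = z^-1 * (w * `|I|).
    by rewrite /z; field; rewrite !gt_eqF.
  have -> : Num.min 1 z^-1 = z^-1 * Num.min z 1.
    rewrite -[in LHS](mulVf (x := z)) ?gt_eqF// -[X in Num.min _ X]mulr1.
    by rewrite minr_pMr// ltW// invr_gt0.
  by rewrite [leRHS]mulrCA ler_pM2l// invr_gt0.
move=> HJ; rewrite -real_normK ?num_real//.
apply: (@le_trans _ _ ((2 * S * Num.min 1 z^-1) ^+ 2)).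
  by rewrite ler_sqr ?nnegrE// (le_trans _ HJ).
rewrite exprMn (_ : (2 * S) ^+ 2 = 16 * X); last first.
  by rewrite /S mulrA exprMn sqr_sqrtr// -natrM -natrX.
by rewrite ler_wpM2l ?mulr_ge0// min1_inv_sq_le.
Qed.

End Periodic.
End TimeAverage.

(** * A fractional Hardy inequality *)

Section Hardy.
Set Implicit Arguments.
Unset Strict Implicit.
Variable R : realType.
Notation mu := (@lebesgue_measure R).

Lemma powR_exprn (x p : R) (j : nat) : 0 <= x -> (x ^+ j) `^ p = (x `^ p) ^+ j.
Proof. by move=> x0; rewrite -powR_mulrn// powRAC powR_mulrn// powR_ge0. Qed.

Lemma half_powR_lt1 (p : R) : 0 < p -> (2^-1 : R) `^ p < 1.
Proof.
move=> p0; have := @gt0_ltr_powR R p p0 2^-1 1; rewrite powR1.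
by apply; rewrite ?nnegrE// invf_lt1// ltr1n.
Qed.

Lemma sum_geometric_le (x : R) (n : nat) : 0 <= x -> x < 1 ->
  \sum_(j < n) x ^+ j <= (1 - x)^-1.
Proof.
move=> x0 x1; have y0 : 0 < 1 - x by rewrite subr_gt0.
rewrite -[leRHS]div1r ler_pdivlMr//.
have -> : (\sum_(j < n) x ^+ j) * (1 - x) = 1 - x ^+ n.
  have := subrXX 1 x n; rewrite expr1n mulrC => ->; congr (_ * _).
  by apply: eq_bigr => i _; rewrite expr1n mul1r.
by rewrite lerBlDr lerDl exprn_ge0.
Qed.

Lemma measurable_integral_section (D : set R) (F : R * R -> \bar R) :
  measurable D -> measurable_fun setT F -> (forall p, (0 <= F p)%E) ->
  measurable_fun [set: R] (fun m : R => \int[mu]_(m' in D) F (m, m'))%E.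
Proof.
move=> mD mF F0.
have mDD : measurable ([set: R] `*` D) by exact: measurableX.
have mFD : measurable_fun setT (F \_ ([set: R] `*` D)).
  by apply/(measurable_restrictT _ _).1 => //; exact: measurable_funTS.
have FD0 p : (0 <= (F \_ ([set: R] `*` D)) p)%E by exact: erestrict_ge0.
have := @measurable_fun_fubini_tonelli_F _ _ (measurableTypeR R)
  (measurableTypeR R) R mu _ mFD FD0.
congr measurable_fun; apply/funext => m; rewrite /fubini_F [RHS]integral_mkcond.
apply: eq_integral => m' _; rewrite !patchE.
rewrite (_ : ((m, m') \in [set: R] `*` D) = (m' \in D))//.
by apply/idP/idP => [/set_mem[] _|/set_mem]; rewrite inE.
Qed.

(** The three factors come from comparing the weight with its value at the left
    end of a dyadic interval, from the decay of the dyadic means, and from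
    summing a geometric series. *)
Definition hardy_const (s beta : R) : R :=
  2^-1 `^ (- beta) * (1 + 3 / (1 - 2^-1 `^ (s - 2^-1))) ^+ 2 *
  (1 - 2^-1 `^ (2 * s - beta))^-1.

Lemma hardy_const_ge0 (s beta : R) : beta < 2 * s -> 0 <= hardy_const s beta.
Proof.
move=> bs; apply: mulr_ge0.
  by apply: mulr_ge0; [exact: powR_ge0|exact: sqr_ge0].
by rewrite invr_ge0 subr_ge0 ltW// half_powR_lt1// subr_gt0.
Qed.

(** [N m] plays the role of the squared norm of a Hilbert space valued function at
    [m], and [d (m, m')] that of the squared norm of a difference; the only
    link between them is the quadratic form [Nd] of the triangle inequality.
    It is required on a set [G] of full measure only, since fibers outside the
    Sobolev space may form a null set. *)
Variables (s : R) (s_gt : 2^-1 < s).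
Variables (G : set R) (N : R -> \bar R) (d : R * R -> \bar R).
Hypotheses (mG : measurable G) (G01 : G `<=` `]0, 1])
  (G_full : mu (`]0, 1] `\` G) = 0%E)
  (mN : measurable_fun setT N) (N0 : forall m, (0 <= N m)%E)
  (md : measurable_fun setT d) (d0 : forall p, (0 <= d p)%E)
  (Nd : forall eta m m', 0 < eta -> G m -> G m' ->
     (N m <= (1 + eta)%:E * N m' + (1 + eta^-1)%:E * d (m, m'))%E)
  (N1 : (\int[mu]_(m in G) N m <= 1)%E)
  (d1 : (\int[mu]_(m in G) \int[mu]_(m' in G)
     (d (m, m') * ((`|m - m'| `^ (1 + 2 * s))^-1)%:E) <= 1)%E)
  (N_vanish : forall tau, 0 < tau ->
     exists2 delta, 0 < delta & forall m, G m -> m < delta -> (N m <= tau%:E)%E).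

Let h (j : nat) : R := 2^-1 ^+ j.
Let I (j : nat) : set R := G `&` `]h j.+1, h j].
Let Q j := (\int[mu]_(m in I j) N m)%E.

Let h0 j : 0 < h j. Proof. by rewrite exprn_gt0// invr_gt0. Qed.

Let hS j : h j.+1 = h j / 2. Proof. by rewrite /h exprSr. Qed.

Let h_le1 j : h j <= 1.
Proof. by rewrite exprn_ile1// ?invr_ge0// invf_le1// ler1n. Qed.

Let h_lt j : h j.+1 < h j. Proof. by rewrite hS ltr_pdivrMr// ltr_pMr// ltr1n. Qed.

Let mI j : measurable (I j). Proof. exact: measurableI. Qed.

(** The Borel structure of [R] is presented in two convertible ways, as that of
    [R] and as that of [measurableTypeR R].  Some facts are repeated in the
    second form, in which integrals for Lebesgue measure ask for them. *)
Let mI' j : measurable (I j : set (measurableTypeR R)). Proof. exact: mI. Qed.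

Let I_sub j : I j `<=` G. Proof. by move=> x []. Qed.

Let muI j : mu (I j) = (h j.+1)%:E.
Proof.
have itvE : `]h j.+1, h j]%classic = I j `|` (`]h j.+1, h j] `\` G).
  by rewrite /I setIC setUIDK.
have : mu `]h j.+1, h j]%classic = (h j.+1)%:E.
  rewrite lebesgue_measure_itv/= lte_fin h_lt -EFinB; congr _%:E.
  by rewrite hS; lra.
have mJ : measurable (`]h j.+1, h j]%classic `\` G) by exact: measurableD.
rewrite itvE measureU0//.
apply: (@subset_measure0 _ _ _ mu _ (`]0, 1] `\` G)) => //.
- exact: measurableD.
- move=> x [/= xI nG]; split=> //; move: xI; rewrite /= !in_itv/= => /andP[h1 h2].
  by rewrite (lt_trans (h0 _) h1) (le_trans h2).
Qed.

Let F (p : R * R) := (d p * ((`|p.1 - p.2| `^ (1 + 2 * s))^-1)%:E)%E.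

Let F0 p : (0 <= F p)%E.
Proof. by rewrite mule_ge0// lee_fin invr_ge0 powR_ge0. Qed.

Let mF : measurable_fun setT F.
Proof.
apply: emeasurable_funM => //; apply/measurable_EFinP.
rewrite (_ : (fun _ => _) = (fun p => `|p.1 - p.2| `^ (- (1 + 2 * s)))); last first.
  by apply/funext => p; rewrite powRN.
apply: (measurableT_comp (measurable_powR _)).
apply: measurableT_comp => //; apply: measurable_funB.
  exact: measurable_fst.
exact: measurable_snd.
Qed.

Let e m := (\int[mu]_(m' in G) F (m, m'))%E.

Let e0 m : (0 <= e m)%E. Proof. exact: integral_ge0. Qed.

Let me : measurable_fun setT e.
Proof.
exact: measurable_integral_section.
Qed.

Let mND (D : set (measurableTypeR R)) : measurable_fun D N.
Proof. exact: (measurable_funTS mN). Qed.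

Let mFD m (D : set (measurableTypeR R)) : measurable_fun D (fun m' => F (m, m')).
Proof.
have mFm : measurable_fun setT (fun m' => F (m, m')) by exact: measurable_fun_pair2.
exact: (measurable_funTS mFm).
Qed.

Let meD (D : set (measurableTypeR R)) : measurable_fun D e.
Proof. exact: (measurable_funTS me). Qed.

Let e1 : (\int[mu]_(m in G) e m <= 1)%E. Proof. exact: d1. Qed.

Let d_le_F j m m' : I j m -> I j.+1 m' ->
  (d (m, m') <= (h j `^ (1 + 2 * s))%:E * F (m, m'))%E.
Proof.
move=> [_ /=]; rewrite in_itv/= => /andP[hm mh] [_ /=].
rewrite in_itv/= => /andP[hm' mh'].
rewrite /F muleCA -EFinM /= -[leLHS]mule1 lee_wpmul2l// lee_fin.
have mm : 0 < m - m' by rewrite subr_gt0 (le_lt_trans mh').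
have k0 : 0 < `|m - m'| `^ (1 + 2 * s) by rewrite powR_gt0// normr_gt0 gt_eqF.
rewrite ler_pdivlMr// mul1r ge0_ler_powR ?nnegrE//.
- by have s2 := s_gt; lra.
- exact: ltW.
- by rewrite gtr0_norm// lerBlDr (le_trans mh)// lerDl ltW// (lt_trans _ hm').
Qed.

(** Average [Nd] over [m] in [I j] and [m'] in [I j.+1]: there the distance from
    [m] to [m'] is at most [h j], so [d] is at most [h j `^ (1 + 2 * s)] times
    the Gagliardo integrand. *)
Let Q_step j eta : 0 < eta ->
  ((h j.+2)%:E * Q j <= ((1 + eta) * h j.+1)%:E * Q j.+1 +
     ((1 + eta^-1) * h j `^ (1 + 2 * s))%:E)%E.
Proof.
move=> eta0; have c0 : 0 < eta^-1 by rewrite invr_gt0.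
set c := (1 + eta^-1) * h j `^ (1 + 2 * s).
have cc0 : 0 <= c by rewrite mulr_ge0 ?powR_ge0//; lra.
have pw m : I j m -> ((h j.+2)%:E * N m <= (1 + eta)%:E * Q j.+1 + c%:E * e m)%E.
  move=> Im.
  have -> : ((h j.+2)%:E * N m = \int[mu]_(m' in I j.+1) cst (N m) m')%E.
    by rewrite integral_cst// [X in (_ = _ * X)%E]muI muleC.
  apply: (@le_trans _ _ (\int[mu]_(m' in I j.+1)
     ((1 + eta)%:E * N m' + c%:E * F (m, m')))%E).
    apply: ge0_le_integral => //.
    - by move=> m1 _; exact: N0.
    - by apply: emeasurable_funD; exact: measurable_funeM.
    - move=> m' Im'; apply: (le_trans (Nd eta0 (I_sub Im) (I_sub Im'))).
      rewrite leeD2l// /c EFinM -muleA lee_wpmul2l//; last exact: d_le_F.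
      by rewrite lee_fin; lra.
  rewrite ge0_integralD//; last 4 first.
  - by move=> m' _; rewrite mule_ge0// lee_fin; lra.
  - by exact: measurable_funeM.
  - by move=> m' _; rewrite mule_ge0.
  - by exact: measurable_funeM.
  rewrite ge0_integralZl//; last by rewrite lee_fin; lra.
  rewrite ge0_integralZl//.
  by rewrite leeD2l// lee_wpmul2l// ge0_subset_integral.
rewrite -ge0_integralZl//; last by rewrite lee_fin ltW.
apply: (@le_trans _ _ (\int[mu]_(m in I j) ((1 + eta)%:E * Q j.+1 + c%:E * e m))%E).
  apply: ge0_le_integral => //.
  - by move=> m _; rewrite mule_ge0// lee_fin ltW.
  - by exact: measurable_funeM.
  - apply: emeasurable_funD => //; exact: measurable_funeM.
have Q0 : (0 <= (1 + eta)%:E * Q j.+1)%E.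
  by rewrite mule_ge0// ?lee_fin; [lra|exact: integral_ge0].
rewrite ge0_integralD//; last 2 first.
- by move=> m _; rewrite mule_ge0.
- by exact: measurable_funeM.
have -> : (\int[mu]_(m in I j) cst ((1 + eta)%:E * Q j.+1) m =
    ((1 + eta) * h j.+1)%:E * Q j.+1)%E.
  by rewrite integral_cst// [X in (_ * X = _)%E]muI muleAC -EFinM.
rewrite leeD2l//.
rewrite ge0_integralZl//.
rewrite -[leRHS]mule1 lee_wpmul2l//.
by apply: le_trans e1; exact: ge0_subset_integral.
Qed.

Let r : R := 2^-1 `^ (s - 2^-1).

Let r_gt0 : 0 < r. Proof. by rewrite powR_gt0 ?invr_gt0. Qed.

Let r_lt1 : r < 1.
Proof. by have s2 := s_gt; rewrite /r half_powR_lt1// subr_gt0. Qed.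

Let h_powR j : h j `^ (1 + 2 * s) = h j ^+ 2 * (r ^+ j) ^+ 2.
Proof.
have hr : r ^+ j = h j `^ (s - 2^-1) by rewrite /h powR_exprn// invr_ge0.
pose t := s - 2^-1; have st : 1 + 2 * s = 1 + 1 + (t + t) by rewrite /t; lra.
rewrite st hr -/t; have hj : h j != 0 by rewrite gt_eqF.
by rewrite !(powRD, powRr1) ?hj ?implybT ?ltW// !expr2.
Qed.

Let Q_fin j : Q j \is a fin_num.
Proof.
rewrite ge0_fin_numE; last exact: integral_ge0.
apply: (@le_lt_trans _ _ 1%E); last exact: ltry.
apply: le_trans N1; exact: ge0_subset_integral.
Qed.

(** With [q j] the mean of [N] over [I j], the choice [eta = 3 * r ^+ j / A] turns
    [Q_step] into the triangle inequality
    [sqrt (q j) <= sqrt (q j.+1) + 3 * r ^+ j], stated without square roots.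
    The 3 is an upper bound for the square root of 8. *)
Let Q_rec j A : 0 < A -> (Q j.+1 <= (h j.+2 * A ^+ 2)%:E)%E ->
  (Q j <= (h j.+1 * (A + 3 * r ^+ j) ^+ 2)%:E)%E.
Proof.
move=> A0; have p0 : 0 < r ^+ j by exact: exprn_gt0.
have eta0 : 0 < 3 * r ^+ j / A by rewrite divr_gt0// mulr_gt0.
have := Q_step j eta0.
rewrite -(fineK (Q_fin j)) -(fineK (Q_fin j.+1)) h_powR.
rewrite -!EFinM -EFinD !lee_fin (hS j.+1) (hS j).
move: (r ^+ j) (fine _) (fine _) p0 eta0 (h0 j) => p x y p0 eta0.
move: (h j) => H H0 step yA.
have H40 : 0 < H / 2 / 2 by rewrite !divr_gt0.
rewrite -(ler_pM2l H40); apply: (le_trans step).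
apply: (@le_trans _ _ ((1 + 3 * p / A) * (H / 2) * (H / 2 / 2 * A ^+ 2) +
    (1 + (3 * p / A)^-1) * (H ^+ 2 * p ^+ 2))).
  rewrite lerD2r ler_wpM2l// mulr_ge0 ?divr_ge0 ?ltW//.
  by rewrite addr_gt0.
rewrite -subr_ge0.
have -> : H / 2 / 2 * (H / 2 * (A + 3 * p) ^+ 2) -
  ((1 + 3 * p / A) * (H / 2) * (H / 2 / 2 * A ^+ 2) +
    (1 + (3 * p / A)^-1) * (H ^+ 2 * p ^+ 2)) =
  H ^+ 2 * (p * (p / 8 + A / 24)).
  by field; rewrite !gt_eqF.
by rewrite mulr_ge0 ?sqr_ge0// mulr_ge0 ?ltW// addr_gt0// divr_gt0.
Qed.

Let half_pow_lt x : 0 < x -> exists n, h n < x.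
Proof.
move=> x0; exists (Num.bound x^-1); rewrite /h exprVn invf_plt ?posrE ?exprn_gt0//.
apply: (lt_trans (archi_boundP _)); first by rewrite invr_ge0 ltW.
by rewrite -natrX ltr_nat ltn_expl.
Qed.

Let h_le i j : (i <= j)%N -> h j <= h i.
Proof. by move=> ij; rewrite /h ler_wiXn2l// ?invr_ge0// invf_le1// ler1n. Qed.

(** Since [N] vanishes at 0, the mean of [N] over [I (j + J)] is at most [tau ^+ 2]
    for large [J].  From there back to [I j], the increments [3 * r ^+ i] of
    [Q_rec] telescope as differences of [K * r ^+ i]. *)
Let Q_decay j :
  (Q j <= (h j.+1 * ((1 + 3 / (1 - r)) * r ^+ j) ^+ 2)%:E)%E.
Proof.
pose tau := r ^+ j; pose K := 3 / (1 - r).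
have tau0 : 0 < tau by exact: exprn_gt0.
have K0 : 0 < K by rewrite divr_gt0// subr_gt0.
have [delta delta0 Ntau] := N_vanish (exprn_gt0 2 tau0).
have [J hJ] := half_pow_lt delta0.
have QJ : (Q (j + J) <= (h (j + J).+1 * (tau + K * r ^+ (j + J)) ^+ 2)%:E)%E.
  apply: (@le_trans _ _ (\int[mu]_(m in I (j + J)) cst (tau ^+ 2)%:E m)%E).
    apply: ge0_le_integral => //.
    move=> m Im; apply: Ntau; first exact: I_sub Im.
    case: Im => _ /=; rewrite in_itv/= => /andP[_ /le_lt_trans]; apply.
    by rewrite (le_lt_trans _ hJ)// h_le// leq_addl.
  rewrite integral_cst// [X in (_ * X <= _)%E]muI -EFinM lee_fin mulrC.
  have t2 : 0 <= K * r ^+ (j + J) by rewrite mulr_ge0 ?exprn_ge0// ltW.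
  rewrite ler_wpM2l ?(ltW (h0 _))// ler_sqr ?nnegrE ?(ltW tau0)//.
    by rewrite lerDl.
  by rewrite addr_ge0 ?t2// ltW.
have rec i : (Q (j + i) <= (h (j + i).+1 * (tau + K * r ^+ (j + i)) ^+ 2)%:E)%E ->
    (Q j <= (h j.+1 * (tau + K * r ^+ j) ^+ 2)%:E)%E.
  elim: i => [|i IH]; first by rewrite addn0.
  rewrite addnS => /Q_rec QQ; apply: IH.
  apply: (le_trans (QQ _)); first by rewrite addr_gt0// mulr_gt0// exprn_gt0.
  rewrite (exprS r) (_ : _ + _ + _ = tau + K * r ^+ (j + i))//.
  have r1 : 1 - r != 0 by rewrite subr_eq0 eq_sym lt_eqF.
  by rewrite /K; field.
apply: (le_trans (rec J QJ)).
by rewrite /tau -/K mulrDl mul1r.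
Qed.

Let G_bigcup : G = \bigcup_j I j.
Proof.
apply/seteqP; split=> [x Gx|x [j _ []]//].
have := G01 Gx; rewrite /= in_itv/= => /andP[x0 x1].
have [n hn] := half_pow_lt x0.
have ex : exists n, h n < x by exists n.
case: (ex_minnP ex) => -[|i] hi imin.
  by move: hi; rewrite /h expr0 ltNge x1.
exists i => //; split=> //=; rewrite in_itv/= hi/= leNgt.
by apply/negP => /imin; rewrite ltnn.
Qed.

Let trivIset_I : trivIset setT I.
Proof.
apply/trivIsetP => i j _ _; wlog ij : i j / (i < j)%N => [H|_].
  rewrite neq_ltn => /orP[ij|ji]; first by apply: H => //; rewrite ltn_eqF.
  by rewrite setIC; apply: H => //; rewrite ltn_eqF.
rewrite -subset0 => x [[_ /=]]; rewrite in_itv/= => /andP[hx _] [_ /=].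
rewrite in_itv/= => /andP[_ xh]; have := lt_le_trans hx xh.
by rewrite ltNge h_le.
Qed.

(** On [I j] the weighted integral is at most a multiple of
    [h j `^ (2 * s - beta)], and these bounds form a geometric series. *)
Lemma fractional_hardy (beta : R) : 0 <= beta -> beta < 2 * s ->
  (\int[mu]_(m in G) ((m `^ (- beta))%:E * N m) <= (hardy_const s beta)%:E)%E.
Proof.
move=> b0 bs; rewrite /hardy_const -/r.
pose D : R := 2^-1 `^ (- beta); pose K := 1 + 3 / (1 - r).
pose q : R := 2^-1 `^ (2 * s - beta).
have D0 : 0 <= D by exact: powR_ge0.
have q0 : 0 <= q by exact: powR_ge0.
have q1 : q < 1 by rewrite half_powR_lt1// subr_gt0.
have mw (E : set (measurableTypeR R)) :
    measurable_fun E (fun m => ((m `^ (- beta))%:E * N m)%E).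
  apply: emeasurable_funM => //; apply/measurable_EFinP.
  exact: (measurable_funTS (measurable_powR _)).
have w0 m : (0 <= (m `^ (- beta))%:E * N m)%E.
  by rewrite mule_ge0// lee_fin powR_ge0.
have Ij j : (\int[mu]_(m in I j) ((m `^ (- beta))%:E * N m) <=
    (D * K ^+ 2 * q ^+ j)%:E)%E.
  apply: (@le_trans _ _ (\int[mu]_(m in I j) ((h j.+1 `^ (- beta))%:E * N m))%E).
    apply: ge0_le_integral => //.
    - by apply: measurable_funeM; exact: mND.
    - move=> m [_ /=]; rewrite in_itv/= => /andP[hm _].
      rewrite lee_wpmul2r// lee_fin !powRN lef_pV2 ?posrE ?powR_gt0//.
        by rewrite ge0_ler_powR ?nnegrE// ltW// (lt_trans _ hm).
      exact: lt_trans hm.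
  rewrite ge0_integralZl//; last by rewrite lee_fin powR_ge0.
  apply: (@le_trans _ _ ((h j.+1 `^ (- beta))%:E *
      (h j.+1 * (K * r ^+ j) ^+ 2)%:E)%E).
    by apply: lee_wpmul2l; [rewrite lee_fin powR_ge0|exact: Q_decay].
  rewrite -EFinM lee_fin.
  have -> : h j.+1 `^ (- beta) = h j `^ (- beta) * D.
    by rewrite hS powRM// ?ltW// invr_ge0.
  have -> : q ^+ j = h j `^ (- beta) * (h j * (r ^+ j) ^+ 2).
    have hj : h j != 0 by rewrite gt_eqF.
    apply: (mulfI hj); rewrite mulrCA [h j * (h j * _)]mulrA -expr2 -h_powR.
    rewrite /q -powR_exprn ?invr_ge0// -/(h j).
    rewrite -{1}(powRr1 (ltW (h0 j))) -!powRD ?hj ?implybT//.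
    by congr (_ `^ _); ring.
  have hh := ltW (h_lt j).
  rewrite exprMn -subr_ge0.
  have -> : D * K ^+ 2 * (h j `^ (- beta) * (h j * (r ^+ j) ^+ 2)) -
     h j `^ (- beta) * D * (h j.+1 * (K ^+ 2 * (r ^+ j) ^+ 2)) =
     D * h j `^ (- beta) * (K ^+ 2 * (r ^+ j) ^+ 2) * (h j - h j.+1) by ring.
  apply: mulr_ge0; last by rewrite subr_ge0.
  by apply: mulr_ge0; [rewrite mulr_ge0 ?powR_ge0|rewrite mulr_ge0 ?sqr_ge0].
rewrite G_bigcup ge0_integral_bigcup//.
apply: lime_le; first by apply: is_cvg_nneseries => n _ _; exact: integral_ge0.
apply: nearW => n; rewrite big_mkord.
apply: (@le_trans _ _ (\sum_(j < n) (D * K ^+ 2 * q ^+ j)%:E)%E).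
  by apply: lee_sum => j _; exact: Ij.
have DK : 0 <= D * K ^+ 2 by apply: mulr_ge0 => //; exact: sqr_ge0.
rewrite sumEFin lee_fin -mulr_sumr; apply: ler_wpM2l => //.
exact: sum_geometric_le.
Qed.

End Hardy.

(** * The Fourier energy of a fiber *)

Section Energy.
Local Open Scope complex_scope.
Set Implicit Arguments.
Unset Strict Implicit.
Variable R : realType.
Notation mu := (@lebesgue_measure R).

Definition weighted_sqsum (c : nat -> R) : \bar R :=
  (\sum_(0 <= k <oo) (k.+1%:R ^+ 2 * c k.+1 ^+ 2)%:E)%E.

Lemma weighted_sqsum_ge0 (c : nat -> R) : (0 <= weighted_sqsum c)%E.
Proof. by apply: nneseries_ge0 => k _ _; rewrite lee_fin mulr_ge0 ?sqr_ge0. Qed.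

(** Termwise, the difference of the two sides is a square divided by [eta]. *)
Lemma weighted_sqsum_le (a b : nat -> R) (eta : R) : 0 < eta ->
  (weighted_sqsum a <= (1 + eta)%:E * weighted_sqsum b +
     (1 + eta^-1)%:E * weighted_sqsum (fun k => a k - b k)%R)%E.
Proof.
move=> eta0; have i0 : 0 < eta^-1 by rewrite invr_gt0.
have p0 (c : nat -> R) k : (0 <= (k.+1%:R ^+ 2 * c k.+1 ^+ 2)%:E)%E.
  by rewrite lee_fin mulr_ge0 ?sqr_ge0.
rewrite /weighted_sqsum -!nneseriesZl//; last first.
  by move=> k _; exact: (p0 (fun k => a k - b k)).
rewrite -nneseriesD//; last 2 first.
- move=> k _ _; apply: mule_ge0; rewrite lee_fin.
    by rewrite addr_ge0// ltW.
  by apply: mulr_ge0; exact: sqr_ge0.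
- move=> k _ _; apply: mule_ge0; rewrite lee_fin.
    by rewrite addr_ge0// ltW.
  by apply: mulr_ge0; exact: sqr_ge0.
apply: lee_nneseries => // k _; rewrite -!EFinM -EFinD lee_fin.
rewrite [X in _ <= X + _]mulrCA [X in _ <= _ + X]mulrCA -mulrDr.
apply: ler_wpM2l; first exact: sqr_ge0.
move: (a k.+1) (b k.+1) => x y; rewrite -subr_ge0.
have -> : (1 + eta) * y ^+ 2 + (1 + eta^-1) * (x - y) ^+ 2 - x ^+ 2 =
    eta^-1 * (x - y - eta * y) ^+ 2 by field; rewrite gt_eqF.
by rewrite mulr_ge0 ?sqr_ge0 ?ltW.
Qed.

(** For a square-integrable [g = u + i v] this is half of [Hdot_sqnorm 1 g]. *)
Definition fourier_energy (u v : R -> R) : \bar R :=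
  (weighted_sqsum (cos_coef u) + weighted_sqsum (sin_coef u) +
   (weighted_sqsum (cos_coef v) + weighted_sqsum (sin_coef v)))%E.

Lemma fourier_energyE (u v : R -> R) : fourier_energy u v =
  (\sum_(0 <= k <oo) (k.+1%:R ^+ 2 * (cos_coef u k.+1 ^+ 2 + sin_coef u k.+1 ^+ 2 +
      (cos_coef v k.+1 ^+ 2 + sin_coef v k.+1 ^+ 2)))%:E)%E.
Proof.
have p0 (c : nat -> R) k : (0 <= (k.+1%:R ^+ 2 * c k.+1 ^+ 2)%:E)%E.
  by rewrite lee_fin mulr_ge0 ?sqr_ge0.
rewrite /fourier_energy /weighted_sqsum -!nneseriesD//.
- by apply: eq_eseriesr => k _; rewrite -!EFinD !mulrDr.
- by move=> k _ _; exact: adde_ge0.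
- by move=> k _ _; exact: adde_ge0.
Qed.

Lemma sqmodE (z : R[i]) : sqmod z = (complex.Re z ^+ 2 + complex.Im z ^+ 2)%:E.
Proof. by case: z => a b; rewrite /sqmod/= sqr_sqrtr// addr_ge0 ?sqr_ge0. Qed.

(** The circle has finite measure, so the pointwise bound [`|w| <= 1 + `|w| ^+ 2]
    suffices. *)
Lemma L2_circle_integrable (g : R -> R[i]) : L2_circle g ->
  mu.-integrable `[0, 1] (EFin \o (fun x => complex.Re (g x))) /\
  mu.-integrable `[0, 1] (EFin \o (fun x => complex.Im (g x))).
Proof.
move=> [_ mRe mIm fin].
have dom (w : R -> R) : measurable_fun setT w ->
    (forall x, (`|w x| ^+ 2)%:E <= sqmod (g x))%E ->
    mu.-integrable `[0, 1] (EFin \o w).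
  move=> mw wg; apply/integrableP; split.
    by apply/measurable_EFinP; exact: measurable_funTS.
  have msq : measurable_fun (`[0, 1]%classic : set R) (fun x => sqmod (g x)).
    rewrite (_ : (fun x => sqmod (g x)) =
        (fun x => (complex.Re (g x) ^+ 2 + complex.Im (g x) ^+ 2)%:E)); last first.
      by apply/funext => x; rewrite sqmodE.
    by apply/measurable_EFinP/measurable_funTS; apply: measurable_funD; apply: measurable_funX.
  apply: (@le_lt_trans _ _ (\int[mu]_(x in `[0%R, 1%R]) (1%:E + sqmod (g x)))%E).
    apply: ge0_le_integral => //.
    - apply: measurableT_comp => //; apply/measurable_EFinP; exact: measurable_funTS.
    - by apply: emeasurable_funD.
    - move=> x _ /=; apply: le_trans (leeD2l _ (wg x)); rewrite -EFinD lee_fin.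
      have := sqr_ge0 (`|w x| - 2^-1); rewrite sqrrB; have := normr_ge0 (w x).
      by move: `|w x| => y; lra.
  rewrite ge0_integralD//; last by move=> x _; rewrite sqmodE lee_fin addr_ge0 ?sqr_ge0.
  rewrite integral_cst// mul1e; apply: lte_add_pinfty => //.
  by have := @lebesgue_measure_itv R `[0, 1]; rewrite /= lte01 => ->; rewrite -EFinB ltry.
by split; apply: dom => // x; rewrite sqmodE lee_fin real_normK ?num_real//
  (lerDl, lerDr) sqr_ge0.
Qed.

Section Modes.
Variable g : R -> R[i].
Let u x := complex.Re (g x).
Let v x := complex.Im (g x).
Hypotheses (ui : mu.-integrable `[0, 1] (EFin \o u))
  (vi : mu.-integrable `[0, 1] (EFin \o v)).

Lemma fourier_coef_nat (k : nat) : fourier_coef g k =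
  (cos_coef u k + sin_coef v k) +i* (cos_coef v k - sin_coef u k).
Proof.
rewrite /fourier_coef /Cintegral /cos_coef /sin_coef.
rewrite -RintegralD//; [|exact: integrable_mul_cos|exact: integrable_mul_sin].
rewrite -RintegralB//; [|exact: integrable_mul_cos|exact: integrable_mul_sin].
congr (_ +i* _); apply: eq_Rintegral => x _; rewrite /u /v; case: (g x) => a b /=;
  rewrite -[k%:~R]/(k%:R); move: (cos _) (sin _) => c s; ring.
Qed.

Lemma fourier_coef_oppnat (k : nat) : fourier_coef g (- k%:Z) =
  (cos_coef u k - sin_coef v k) +i* (cos_coef v k + sin_coef u k).
Proof.
have ang (x : R) : 2 * pi * (- k%:Z)%:~R * x = - (2 * pi * k%:R * x).
  by rewrite mulrNz mulrN mulNr.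
rewrite /fourier_coef /Cintegral /cos_coef /sin_coef.
rewrite -RintegralD//; [|exact: integrable_mul_cos|exact: integrable_mul_sin].
rewrite -RintegralB//; [|exact: integrable_mul_cos|exact: integrable_mul_sin].
congr (_ +i* _); apply: eq_Rintegral => x _; rewrite /u /v; case: (g x) => a b /=;
  rewrite ang cosN sinN; move: (cos _) (sin _) => c s; ring.
Qed.

Let term k : \bar R :=
  ((`|k%:~R| `^ (2 * 1))%:E * sqmod (fourier_coef g k))%E.

Let term0 k : (0 <= term k)%E.
Proof. by rewrite mule_ge0 ?sqmodE ?lee_fin ?powR_ge0 ?addr_ge0 ?sqr_ge0. Qed.

Let half_sum (e : nat -> int) : injective e ->
  (\sum_(0 <= k <oo) term (e k) <= Hdot_sqnorm 1 g)%E.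
Proof.
move=> ie; rewrite nneseries_esumT//.
have bij : set_bij [set: nat] (range e) e.
  split=> [x _|x y _ _|_ [x _ <-]]; by [exists x|exact: ie].
rewrite -(reindex_esum _ _ _ _ bij) esum_mkcond /Hdot_sqnorm.
by apply: le_esum => k _; case: ifP => _ //; exact: term0.
Qed.

Let termE (e : nat -> int) : (forall k, `|e k|%N = k.+1) -> forall k,
  term (e k) = ((k.+1%:R ^+ 2)%:E * sqmod (fourier_coef g (e k)))%E.
Proof.
move=> ek k; rewrite /term mulr1 -[2]/(2%:R) powR_mulrn//.
by rewrite -intr_norm -abszE ek.
Qed.

(** By the parallelogram identity, the squares of the four real coefficients of
    frequency [k] add up to half of the squared moduli of the complex
    coefficients at [k] and [- k].  The sums over the positive and over the
    negative frequencies are each at most the sum over all of them. *)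
Lemma fourier_energy_le_Hdot : (fourier_energy u v <= Hdot_sqnorm 1 g)%E.
Proof.
rewrite fourier_energyE.
pose p (k : nat) := k.+1%:Z; pose m (k : nat) := - k.+1%:Z.
have tp := termE (e := p) (fun k => erefl).
have tm : forall k, term (m k) = ((k.+1%:R ^+ 2)%:E * sqmod (fourier_coef g (m k)))%E.
  by apply: termE => k; rewrite /m abszN.
have -> : (\sum_(0 <= k <oo) (k.+1%:R ^+ 2 * (cos_coef u k.+1 ^+ 2 + sin_coef u k.+1 ^+ 2 +
      (cos_coef v k.+1 ^+ 2 + sin_coef v k.+1 ^+ 2)))%:E =
   \sum_(0 <= k <oo) ((2^-1)%:E * (term (p k) + term (m k))))%E.
  apply: eq_eseriesr => k _; rewrite tp tm fourier_coef_nat fourier_coef_oppnat.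
  rewrite !sqmodE -!EFinM; congr _%:E => /=.
  move: (cos_coef u _) (sin_coef u _) (cos_coef v _) (sin_coef v _) (k.+1%:R : R) => *.
  by field.
rewrite nneseriesZl; last by move=> k _; exact: adde_ge0.
rewrite nneseriesD//.
have pi' : injective p by move=> x y [].
have mi' : injective m by move=> x y /oppr_inj [].
have := leeD (half_sum pi') (half_sum mi').
move: (\sum_(_ <= _ <oo) _ + _)%E (Hdot_sqnorm 1 g) => A B AB.
apply: (@le_trans _ _ ((2^-1)%:E * (B + B))%E).
  by rewrite lee_wpmul2l.
case: B {AB} => [b| |].
- by rewrite -EFinD -EFinM lee_fin; lra.
- exact: leey.
- by rewrite addeNy gt0_muleNy// lte_fin invr_gt0.
Qed.

Lemma mean_zero_of_fourier_coef0 : fourier_coef g 0 = 0 ->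
  \int[mu]_(x in `[0, 1]) u x = 0 /\ \int[mu]_(x in `[0, 1]) v x = 0.
Proof.
have c0 (w : R -> R) : cos_coef w 0 = \int[mu]_(x in `[0, 1]) w x.
  by apply: eq_Rintegral => x _; rewrite mulr0 mul0r cos0 mulr1.
have s0 (w : R -> R) : sin_coef w 0 = 0.
  transitivity (\int[mu]_(x in `[0, 1]) (0 : R)).
    by apply: eq_Rintegral => x _; rewrite mulr0 mul0r sin0 mulr0.
  by rewrite Rintegral_cst// mul0r.
by rewrite (fourier_coef_nat 0) !c0 !s0 addr0 subr0 => -[].
Qed.

End Modes.
End Energy.

(** * The pointwise estimate of the time average *)

Section Fiber.
Set Implicit Arguments.
Unset Strict Implicit.
Variable R : realType.
Notation mu := (@lebesgue_measure R).

Lemma Hdot_periodic_parts (gamma : R) (g : R -> R[i]) : Hdot gamma g ->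
  one_periodic (fun x => complex.Re (g x)) /\ one_periodic (fun x => complex.Im (g x)).
Proof. by move=> [[[pg _ _ _] _] _]; split=> x; rewrite pg. Qed.

Lemma sqmod_time_average_le (phi : R -> R) (T : R) (f : R -> R -> R[i]) (m x l : R) :
  Hdot 1 (f m) -> 0 < phi m -> 0 < T -> 0 <= l -> l <= 2 ->
  (sqmod (time_average phi T f m x) <=
   (32 * (2 * T * phi m) `^ (- l))%:E *
     fourier_energy (fun y => complex.Re (f m y)) (fun y => complex.Im (f m y)))%E.
Proof.
move=> Hf w0 T0 l0 l2.
have [[L2f f0] Ef] := Hf; have [pf m_u mv _] := L2f.
have [pu pv] := Hdot_periodic_parts Hf.
have [ui vi] := L2_circle_integrable L2f.
have [u0 v0] := mean_zero_of_fourier_coef0 ui vi f0.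
have := le_lt_trans (fourier_energy_le_Hdot ui vi) Ef.
set u := fun y => complex.Re (f m y); set v := fun y => complex.Im (f m y).
move=> Efin; set E := fourier_energy u v in Efin *.
have w_ge0 := @weighted_sqsum_ge0 R.
have E0 : (0 <= E)%E by rewrite !adde_ge0.
have EE : E = (fine E)%:E by rewrite fineK// ge0_fin_numE.
have part (a b : nat -> R) : (weighted_sqsum a + weighted_sqsum b <= E)%E ->
    forall n, \sum_(k < n) k.+1%:R ^+ 2 * (a k.+1 ^+ 2 + b k.+1 ^+ 2) <= fine E.
  move=> abE n; rewrite -lee_fin -EE; apply: le_trans abE.
  rewrite /weighted_sqsum -nneseriesD//; last 2 first.
  - by move=> k _ _; rewrite lee_fin mulr_ge0 ?sqr_ge0.
  - by move=> k _ _; rewrite lee_fin mulr_ge0 ?sqr_ge0.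
  apply: le_trans (nneseries_lim_ge n _); last first.
    by move=> k _ _; rewrite -EFinD lee_fin addr_ge0// mulr_ge0 ?sqr_ge0.
  rewrite big_mkord -sumEFin; apply: lee_sum => k _.
  by rewrite -EFinD lee_fin mulrDr.
have uE := part (cos_coef u) (sin_coef u) (leeDl _ (adde_ge0 (w_ge0 _) (w_ge0 _))).
have vE := part (cos_coef v) (sin_coef v) (leeDr _ (adde_ge0 (w_ge0 _) (w_ge0 _))).
have uT := time_average_sq_le m_u pu ui u0 uE x w0 T0 l0 l2.
have vT := time_average_sq_le mv pv vi v0 vE x w0 T0 l0 l2.
rewrite EE -EFinM sqmodE lee_fin /time_average /Cintegral /=.
rewrite !mul0r subr0 addr0.
apply: (le_trans (lerD uT vT)).
by rewrite le_eqVlt; apply/orP; left; apply/eqP; ring.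
Qed.

End Fiber.

(** * Comparison of integrals and measurability *)

Section LowerIntegral.
Set Implicit Arguments.
Unset Strict Implicit.
Local Open Scope ereal_scope.

(** The integral of a nonnegative function is a supremum over the simple functions
    below it, which is monotone in the function and in the domain whether or
    not the functions are measurable.  Integrals of the time average and of the
    Sobolev norms of the fibers enter only through this comparison. *)
Lemma ge0_le_integral_lower d (T : measurableType d) (R : realType)
    (mu : {measure set T -> \bar R}) (D D' : set T) (f g : T -> \bar R) :
  D `<=` D' -> (forall x, D x -> 0 <= f x) -> (forall x, D' x -> 0 <= g x) ->
  (forall x, D x -> f x <= g x) ->
  \int[mu]_(x in D) f x <= \int[mu]_(x in D') g x.
Proof.
move=> DD' f0 g0 fg; rewrite !ge0_integralE//.
apply: le_ereal_sup => _ [h /= hf <-]; exists h => //= x.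
apply: le_trans (hf x) _; rewrite !patchE; case: ifPn => [/set_mem Dx|_].
  by rewrite mem_set ?fg//; exact: DD'.
by case: ifPn => // /set_mem; exact: g0.
Qed.

End LowerIntegral.

Section Measurability.
Set Implicit Arguments.
Unset Strict Implicit.
Variable R : realType.
Notation mu := (@lebesgue_measure R).

Lemma measurable_weighted_sqsum d (T : measurableType d) (c : nat -> T -> R) :
  (forall k, measurable_fun setT (c k)) ->
  measurable_fun setT (fun t => weighted_sqsum (fun k => c k t)).
Proof.
move=> mc; apply: (@ge0_emeasurable_sum _ _ _ _
  (fun k t => (k.+1%:R ^+ 2 * c k.+1 t ^+ 2)%:E) xpredT) => [k t _ _|k _].
  by rewrite lee_fin mulr_ge0 ?sqr_ge0.
apply/measurable_EFinP; apply: measurable_funM => //.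
exact: measurable_funX.
Qed.

Lemma measurable_Rintegral_section (D : set R) (F : R * R -> R) : measurable D ->
  measurable_fun setT F ->
  measurable_fun [set: R] (fun m : R => \int[mu]_(x in D) F (m, x)).
Proof.
move=> mD mF; apply: (measurableT_comp (fine_measurable measurableT)).
rewrite (_ : (fun _ => _) = (fun m => \int[mu]_(x in D) (EFin \o F)^\+ (m, x) -
    \int[mu]_(x in D) (EFin \o F)^\- (m, x))%E); last first.
  apply/funext => m; rewrite integralE; congr (_ - _)%E;
    by apply: eq_integral => x _; rewrite !(funeposE, funenegE).
have mE : measurable_fun setT (EFin \o F) by exact/measurable_EFinP.
apply: emeasurable_funB; apply: measurable_integral_section => //.
- exact: measurable_funepos.
- exact: measurable_funeneg.
Qed.

Lemma measurable_cos_coef_section (F : R * R -> R) k : measurable_fun setT F ->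
  measurable_fun [set: R] (fun m => cos_coef (fun x => F (m, x)) k).
Proof.
move=> mF; apply: (@measurable_Rintegral_section _
  (fun p => F p * cos (2 * pi * k%:R * p.2))) => //.
apply: measurable_funM => //.
apply: (@measurableT_comp _ _ _ _ _ _ (fun x : R => cos (2 * pi * k%:R * x))).
  exact: measurable_cos_freq.
exact: measurable_snd.
Qed.

Lemma measurable_sin_coef_section (F : R * R -> R) k : measurable_fun setT F ->
  measurable_fun [set: R] (fun m => sin_coef (fun x => F (m, x)) k).
Proof.
move=> mF; apply: (@measurable_Rintegral_section _
  (fun p => F p * sin (2 * pi * k%:R * p.2))) => //.
apply: measurable_funM => //.
apply: (@measurableT_comp _ _ _ _ _ _ (fun x : R => sin (2 * pi * k%:R * x))).
  exact: measurable_sin_freq.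
exact: measurable_snd.
Qed.

Lemma cos_coefB (u v : R -> R) k : mu.-integrable `[0, 1] (EFin \o u) ->
  mu.-integrable `[0, 1] (EFin \o v) ->
  cos_coef (fun x => u x - v x) k = cos_coef u k - cos_coef v k.
Proof.
move=> ui vi; rewrite /cos_coef -RintegralB//; try exact: integrable_mul_cos.
by apply: eq_Rintegral => x _; rewrite mulrBl.
Qed.

Lemma sin_coefB (u v : R -> R) k : mu.-integrable `[0, 1] (EFin \o u) ->
  mu.-integrable `[0, 1] (EFin \o v) ->
  sin_coef (fun x => u x - v x) k = sin_coef u k - sin_coef v k.
Proof.
move=> ui vi; rewrite /sin_coef -RintegralB//; try exact: integrable_mul_sin.
by apply: eq_Rintegral => x _; rewrite mulrBl.
Qed.

Lemma cos_coef_ae (u v : R -> R) k : measurable_fun setT u -> measurable_fun setT v ->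
  {ae mu, forall x, u x = v x} -> cos_coef u k = cos_coef v k.
Proof.
move=> m_u mv uv; rewrite /cos_coef /Rintegral; congr fine.
apply: ae_eq_integral => //.
- apply/measurable_EFinP; apply: measurable_funM; last exact: measurable_cos_freq.
  exact: measurable_funTS.
- apply/measurable_EFinP; apply: measurable_funM; last exact: measurable_cos_freq.
  exact: measurable_funTS.
- case: uv => A [mA A0 uvA]; exists A; split=> // x /= nuv.
  by apply: uvA => /= uvx; apply: nuv => _; rewrite /= uvx.
Qed.

Lemma sin_coef_ae (u v : R -> R) k : measurable_fun setT u -> measurable_fun setT v ->
  {ae mu, forall x, u x = v x} -> sin_coef u k = sin_coef v k.
Proof.
move=> m_u mv uv; rewrite /sin_coef /Rintegral; congr fine.
apply: ae_eq_integral => //.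
- apply/measurable_EFinP; apply: measurable_funM; last exact: measurable_sin_freq.
  exact: measurable_funTS.
- apply/measurable_EFinP; apply: measurable_funM; last exact: measurable_sin_freq.
  exact: measurable_funTS.
- case: uv => A [mA A0 uvA]; exists A; split=> // x /= nuv.
  by apply: uvA => /= uvx; apply: nuv => _; rewrite /= uvx.
Qed.

Lemma fourier_energy_ae (u u' v v' : R -> R) :
  measurable_fun setT u -> measurable_fun setT u' ->
  measurable_fun setT v -> measurable_fun setT v' ->
  {ae mu, forall x, u x = u' x} -> {ae mu, forall x, v x = v' x} ->
  fourier_energy u v = fourier_energy u' v'.
Proof.
move=> m1 m2 m3 m4 uu vv; rewrite /fourier_energy.
have e1 k := cos_coef_ae k m1 m2 uu; have e2 k := sin_coef_ae k m1 m2 uu.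
have e3 k := cos_coef_ae k m3 m4 vv; have e4 k := sin_coef_ae k m3 m4 vv.
by congr (weighted_sqsum _ + weighted_sqsum _ + (weighted_sqsum _ + weighted_sqsum _))%E;
  apply/funext.
Qed.

(** Written with differences of coefficients, not with coefficients of
    differences: only the former are visibly measurable in the pair of fibers
    everywhere.  Both agree for integrable fibers ([fourier_energy_distE]). *)
Definition fourier_energy_dist (u v u' v' : R -> R) : \bar R :=
  (weighted_sqsum (fun k => cos_coef u k - cos_coef u' k)%R +
   weighted_sqsum (fun k => sin_coef u k - sin_coef u' k)%R +
   (weighted_sqsum (fun k => cos_coef v k - cos_coef v' k)%R +
    weighted_sqsum (fun k => sin_coef v k - sin_coef v' k)%R))%E.

Lemma fourier_energy_ge0 (u v : R -> R) : (0 <= fourier_energy u v)%E.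
Proof. by rewrite !adde_ge0// weighted_sqsum_ge0. Qed.

Lemma fourier_energy_dist_ge0 (u v u' v' : R -> R) :
  (0 <= fourier_energy_dist u v u' v')%E.
Proof. by rewrite !adde_ge0// weighted_sqsum_ge0. Qed.

Lemma fourier_energy_triangle (u v u' v' : R -> R) (eta : R) : 0 < eta ->
  (fourier_energy u v <= (1 + eta)%:E * fourier_energy u' v' +
     (1 + eta^-1)%:E * fourier_energy_dist u v u' v')%E.
Proof.
move=> eta0; rewrite /fourier_energy /fourier_energy_dist.
have w0 := @weighted_sqsum_ge0 R.
rewrite !ge0_muleDr ?adde_ge0//.
rewrite [leRHS]addeACA; apply: leeD; rewrite [leRHS]addeACA; apply: leeD;
  exact: weighted_sqsum_le.
Qed.

Lemma fourier_energy_distE (u v u' v' : R -> R) :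
  mu.-integrable `[0, 1] (EFin \o u) -> mu.-integrable `[0, 1] (EFin \o v) ->
  mu.-integrable `[0, 1] (EFin \o u') -> mu.-integrable `[0, 1] (EFin \o v') ->
  fourier_energy_dist u v u' v' =
  fourier_energy (fun x => u x - u' x) (fun x => v x - v' x).
Proof.
move=> iu iv iu' iv'; rewrite /fourier_energy /fourier_energy_dist.
by congr (weighted_sqsum _ + weighted_sqsum _ + (weighted_sqsum _ + weighted_sqsum _))%E;
  apply/funext => k; rewrite ?cos_coefB ?sin_coefB.
Qed.

Lemma measurable_fourier_energy_section (F K : R * R -> R) :
  measurable_fun setT F -> measurable_fun setT K ->
  measurable_fun [set: R]
    (fun m => fourier_energy (fun x => F (m, x)) (fun x => K (m, x))).
Proof.
move=> mF mK; do 2 apply: emeasurable_funD.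
- by apply: (@measurable_weighted_sqsum _ R
    (fun k m => cos_coef (fun x => F (m, x)) k)) => k;
    exact: measurable_cos_coef_section.
- by apply: (@measurable_weighted_sqsum _ R
    (fun k m => sin_coef (fun x => F (m, x)) k)) => k;
    exact: measurable_sin_coef_section.
- by apply: (@measurable_weighted_sqsum _ R
    (fun k m => cos_coef (fun x => K (m, x)) k)) => k;
    exact: measurable_cos_coef_section.
- by apply: (@measurable_weighted_sqsum _ R
    (fun k m => sin_coef (fun x => K (m, x)) k)) => k;
    exact: measurable_sin_coef_section.
Qed.

Lemma measurable_fourier_energy_dist_section (F K : R * R -> R) :
  measurable_fun setT F -> measurable_fun setT K ->
  measurable_fun [set: R * R]
    (fun p => fourier_energy_dist (fun x => F (p.1, x)) (fun x => K (p.1, x))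
                (fun x => F (p.2, x)) (fun x => K (p.2, x))).
Proof.
move=> mF mK.
have diff (c : nat -> R -> R) : (forall k, measurable_fun setT (c k)) ->
    measurable_fun [set: R * R] (fun p => weighted_sqsum (fun k => c k p.1 - c k p.2)).
  move=> mc; apply: (@measurable_weighted_sqsum _ (R * R)%type
    (fun k p => c k p.1 - c k p.2)) => k.
  by apply: measurable_funB; exact: measurableT_comp.
do 2 apply: emeasurable_funD.
- by apply: (diff (fun k m => cos_coef (fun x => F (m, x)) k)) => k;
    exact: measurable_cos_coef_section.
- by apply: (diff (fun k m => sin_coef (fun x => F (m, x)) k)) => k;
    exact: measurable_sin_coef_section.
- by apply: (diff (fun k m => cos_coef (fun x => K (m, x)) k)) => k;
    exact: measurable_cos_coef_section.
- by apply: (diff (fun k m => sin_coef (fun x => K (m, x)) k)) => k;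
    exact: measurable_sin_coef_section.
Qed.

End Measurability.

(** * The norm of the time average *)

Section Core.
Set Implicit Arguments.
Unset Strict Implicit.
Variable R : realType.
Notation mu := (@lebesgue_measure R).
Notation unitI := (`[0, 1]%classic : set R).

Lemma ReB (z w : R[i]) : complex.Re (z - w) = complex.Re z - complex.Re w.
Proof. by case: z w => [a b] [c d]. Qed.

Lemma ImB (z w : R[i]) : complex.Im (z - w) = complex.Im z - complex.Im w.
Proof. by case: z w => [a b] [c d]. Qed.

Lemma fourier_energy_le_Hdot_diff (g h : R -> R[i]) : L2_circle g -> L2_circle h ->
  (fourier_energy (fun x => complex.Re (g x) - complex.Re (h x))%R
                  (fun x => complex.Im (g x) - complex.Im (h x))%R <=
   Hdot_sqnorm 1 (fun x => g x - h x)%R)%E.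
Proof.
move=> /L2_circle_integrable[gr gi] /L2_circle_integrable[hr hi].
have iB (u v : R -> R) : mu.-integrable `[0, 1] (EFin \o u) ->
    mu.-integrable `[0, 1] (EFin \o v) ->
    mu.-integrable `[0, 1] (EFin \o (fun x => u x - v x)).
  move=> iu iv; apply: integrableD_real => //.
  have := integrableZl_real (-1) (measurable_itv _) iv.
  by congr (mu.-integrable _ _); apply/funext => x /=; rewrite mulN1r.
have EB : (fun x => complex.Re (g x - h x)) = (fun x => complex.Re (g x) - complex.Re (h x)).
  by apply/funext => x; rewrite ReB.
have EI : (fun x => complex.Im (g x - h x)) = (fun x => complex.Im (g x) - complex.Im (h x)).
  by apply/funext => x; rewrite ImB.
rewrite -EB -EI; apply: fourier_energy_le_Hdot.
- by rewrite EB; exact: iB.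
- by rewrite EI; exact: iB.
Qed.

Lemma integral_square_fst (W : R -> \bar R) :
  measurable_fun setT W -> (forall m, (0 <= W m)%E) ->
  (\int[(mu \x mu)%E]_(p in unitI `*` unitI) W p.1 = \int[mu]_(m in unitI) W m)%E.
Proof.
move=> mW W0.
pose D : set (R * R) := unitI `*` unitI.
have mD : measurable D by exact: measurableX.
pose F := (fun p : R * R => W p.1) \_ D.
have mF : measurable_fun setT F.
  apply/(measurable_restrictT _ _).1 => //; apply: measurable_funTS.
  exact: measurableT_comp.
have F0 p : (0 <= F p)%E by apply: erestrict_ge0.
rewrite integral_mkcond [RHS]integral_mkcond.
rewrite (@fubini_tonelli1 _ _ (measurableTypeR R) (measurableTypeR R) R mu mu F mF F0).
apply: eq_integral => m _; rewrite /fubini_F [RHS]patchE.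
have mu1 : mu unitI = 1%E.
  by rewrite lebesgue_measure_itv/= lte01 -EFinB subr0.
case: ifPn => [mI|mI].
  transitivity (\int[mu]_(y in unitI) cst (W m) y)%E.
    rewrite [RHS]integral_mkcond; apply: eq_integral => y _.
    rewrite /F !patchE (_ : ((m, y) \in D) = (y \in unitI))//.
    by apply/idP/idP => [/set_mem[] _|/set_mem yI]; rewrite inE //; split=> //=; exact: set_mem mI.
  by rewrite integral_cst// [X in (_ * X = _)%E]mu1 mule1.
rewrite -[RHS](integral0 mu setT); apply: eq_integral => y _.
rewrite /F patchE ifN//; apply: contra mI => /set_mem[/= mI _].
by rewrite inE.
Qed.

Lemma Hdot_sqnorm_ge0 (gamma : R) (g : R -> R[i]) : (0 <= Hdot_sqnorm gamma g)%E.
Proof.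
apply: esum_ge0 => k _; apply: mule_ge0; first by rewrite lee_fin powR_ge0.
by rewrite sqmodE lee_fin addr_ge0 ?sqr_ge0.
Qed.

Lemma sqrte_le1 (x : \bar R) : (0 <= x)%E -> (sqrte x <= 1)%E -> (x <= 1)%E.
Proof.
move=> x0 x1; rewrite -[x]sqr_sqrte// -[leRHS]mul1e expe2.
by apply: lee_pmul => //; exact: sqrte_ge0.
Qed.

Lemma calH_norm_le1 (s gamma : R) (f : R -> R -> R[i]) :
  (calH_norm s gamma f <= 1)%E ->
  (\int[mu]_(m in unitI) Hdot_sqnorm gamma (f m) <= 1)%E /\
  (\int[mu]_(m in unitI) \int[mu]_(m' in unitI)
     (Hdot_sqnorm gamma (fun x => f m x - f m' x)%R *
      ((`|m - m'| `^ (1 + 2 * s))^-1)%:E) <= 1)%E.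
Proof.
have H0 := @Hdot_sqnorm_ge0 gamma.
set A := (\int[mu]_(m in unitI) Hdot_sqnorm gamma (f m))%E.
set B := (\int[mu]_(m in unitI) \int[mu]_(m' in unitI) _)%E.
have A0 : (0 <= A)%E by apply: integral_ge0 => m _; exact: H0.
have B0 : (0 <= B)%E.
  apply: integral_ge0 => m _; apply: integral_ge0 => m' _.
  by rewrite mule_ge0// lee_fin invr_ge0 powR_ge0.
move=> /(sqrte_le1 (adde_ge0 A0 B0)) AB.
by split; apply: le_trans AB; [exact: leeDl|exact: leeDr].
Qed.

Lemma continuous_rep_vanish (gamma : R) (f g : R -> R -> R[i]) (tau : R) :
  continuous_rep gamma f g -> 0 < tau ->
  exists2 delta, 0 < delta & forall m, m \in `[0, 1] -> m < delta ->
    (Hdot_sqnorm gamma (fun x => g m x - g 0 x)%R <= tau%:E)%E.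
Proof.
move=> [_ _ gcont] tau0.
have z01 : (0 : R) \in `[0, 1] by rewrite in_itv/= lexx ler01.
have nb : nbhs 0%E [set y : \bar R | (y < tau%:E)%E].
  apply: open_nbhs_nbhs; split; first exact: open_ereal_lt_ereal.
  by rewrite /= lte_fin.
have := gcont 0 z01 _ nb; rewrite /= nbhs_simpl/= => /nbhs_ballP[e /= e0 He].
exists e => // m m01 me; apply: ltW; apply: He => //=.
by rewrite /ball/= sub0r normrN ger0_norm//; move: m01; rewrite in_itv/= => /andP[].
Qed.

(** [G] collects the [m] whose fiber lies in [Hdot 1] and agrees almost everywhere
    with the continuous representative.  The Hardy inequality is applied on [G]
    to the Fourier energy; near [m = 0] this energy is at most the squared norm
    of [g m - g 0], as [g 0] vanishes almost everywhere. *)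
Lemma time_average_sqnorm_le (phi : R -> R) (c1 alpha s l T : R)
    (f : R -> R -> R[i]) :
  2^-1 < s -> 0 < c1 -> 0 < T ->
  (forall m, 0 < m -> m <= 1 -> c1 * m `^ alpha <= phi m) ->
  0 < alpha -> 0 <= l -> l <= 2 -> alpha * l < 2 * s ->
  calH0 s 1 f -> (calH_norm s 1 f <= 1)%E ->
  (\int[(mu \x mu)%E]_(p in unitI `*` unitI)
     sqmod (time_average phi T f p.1 p.2) <=
   (32 * (2 * T * c1) `^ (- l) * hardy_const s (alpha * l))%:E)%E.
Proof.
move=> s_gt c10 T0 phi_ge alpha0 l0 l2 als Hf f1.
move: Hf => [[[pf mRe mIm _] Hae _] [g Grep g00]].
have [Hg fg _] := Grep; have [fN fD] := calH_norm_le1 f1.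
case: Hae => N1 [mN1 N10 sub1]; case: fg => N2 [mN2 N20 sub2].
pose G : set R := `]0, 1]%classic `\` (N1 `|` N2).
have mG : measurable G by apply: measurableD => //; exact: measurableU.
have G01 : G `<=` `]0, 1] by move=> m [].
have GI m : G m -> m \in `[0, 1].
  by move=> /G01; rewrite /= !in_itv/= => /andP[/ltW -> ->].
have GH m : G m -> Hdot 1 (f m).
  move=> Gm; case: (Gm) => _ nN; apply: contrapT => nH; apply: nN; left.
  by apply: sub1 => /= /(_ (GI m Gm)).
have Gg m : G m -> {ae mu, forall x, g m x = f m x}.
  move=> Gm; case: (Gm) => _ nN; apply: contrapT => nH; apply: nN; right.
  by apply: sub2 => /= /(_ (GI m Gm)).
have G_full : mu (`]0, 1]%classic `\` G) = 0%E.
  have mNN : measurable (N1 `|` N2) by exact: measurableU.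
  apply: (@subset_measure0 _ _ _ mu _ (N1 `|` N2)) => //.
  - by apply: measurableD.
  - by move=> x [x01 nG]; apply: contrapT => nN; apply: nG.
  - exact: null_set_setU.
pose U := (fun p : R * R => complex.Re (f p.1 p.2)) \_ (unitI `*` [set: R]).
pose V := (fun p : R * R => complex.Im (f p.1 p.2)) \_ (unitI `*` [set: R]).
have mIR : measurable (unitI `*` [set: R]) by exact: measurableX.
have mU : measurable_fun setT U by exact/(measurable_restrictT _ _).1.
have mV : measurable_fun setT V by exact/(measurable_restrictT _ _).1.
have inIR m x : G m -> ((m, x) \in unitI `*` [set: R]) = true.
  by move=> Gm; apply/mem_set; split=> //=; exact: GI.
have UE m : G m -> (fun x => U (m, x)) = (fun x => complex.Re (f m x)).
  by move=> Gm; apply/funext => x; rewrite /U patchE inIR.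
have VE m : G m -> (fun x => V (m, x)) = (fun x => complex.Im (f m x)).
  by move=> Gm; apply/funext => x; rewrite /V patchE inIR.
pose N m := fourier_energy (fun x => U (m, x)) (fun x => V (m, x)).
pose d (p : R * R) := fourier_energy_dist (fun x => U (p.1, x)) (fun x => V (p.1, x))
  (fun x => U (p.2, x)) (fun x => V (p.2, x)).
have mN : measurable_fun setT N by exact: measurable_fourier_energy_section.
have md : measurable_fun setT d by exact: measurable_fourier_energy_dist_section.
have N0 m : (0 <= N m)%E by exact: fourier_energy_ge0.
have d0 p : (0 <= d p)%E by exact: fourier_energy_dist_ge0.
have GL m : G m -> L2_circle (f m) by move=> /GH [[]].
have NH m : G m -> (N m <= Hdot_sqnorm 1 (f m))%E.
  move=> Gm; rewrite /N UE// VE//.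
  by have [ui vi] := L2_circle_integrable (GL m Gm); exact: fourier_energy_le_Hdot.
have dH m m' : G m -> G m' ->
    (d (m, m') <= Hdot_sqnorm 1 (fun x => f m x - f m' x)%R)%E.
  move=> Gm Gm'; rewrite /d/= !UE// !VE//.
  have [ui vi] := L2_circle_integrable (GL m Gm).
  have [ui' vi'] := L2_circle_integrable (GL m' Gm').
  rewrite fourier_energy_distE//.
  exact: fourier_energy_le_Hdot_diff (GL m Gm) (GL m' Gm').
have Hd0 := @Hdot_sqnorm_ge0 1.
have N1' : (\int[mu]_(m in G) N m <= 1)%E.
  by apply: le_trans fN; apply: ge0_le_integral_lower => // m /GI.
have k0 (m m' : R) : (0 <= ((`|m - m'| `^ (1 + 2 * s))^-1)%:E)%E.
  by rewrite lee_fin invr_ge0 powR_ge0.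
have d1' : (\int[mu]_(m in G) \int[mu]_(m' in G)
     (d (m, m') * ((`|m - m'| `^ (1 + 2 * s))^-1)%:E) <= 1)%E.
  apply: le_trans fD; apply: ge0_le_integral_lower => //.
  - by move=> m _; apply: integral_ge0 => m' _; apply: mule_ge0.
  - by move=> m _; apply: integral_ge0 => m' _; apply: mule_ge0.
  move=> m Gm; apply: ge0_le_integral_lower => //.
  - by move=> m' _; apply: mule_ge0.
  - by move=> m' _; apply: mule_ge0.
  by move=> m' Gm'; apply: lee_wpmul2r => //; exact: dH.
have Nvan tau : 0 < tau -> exists2 delta, 0 < delta &
    forall m, G m -> m < delta -> (N m <= tau%:E)%E.
  move=> tau0; have [delta delta0 Hdelta] := continuous_rep_vanish Grep tau0.
  exists delta => // m Gm md'; apply: le_trans (Hdelta m (GI m Gm) md').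
  have z01 : (0 : R) \in `[0, 1] by rewrite in_itv/= lexx ler01.
  have Lg : L2_circle (g m) by case: (Hg m (GI m Gm)) => [[]].
  have Lg0 : L2_circle (g 0) by case: (Hg 0 z01) => [[]].
  apply: le_trans (fourier_energy_le_Hdot_diff Lg Lg0).
  have [_ fr fi _] := GL m Gm; have [_ gr gi _] := Lg; have [_ gr0 gi0 _] := Lg0.
  rewrite /N UE// VE// le_eqVlt; apply/orP; left; apply/eqP.
  have [A [mA A0 subA]] := Gg m Gm; have [B [mB B0 subB]] := g00.
  have mAB : measurable (A `|` B) by exact: measurableU.
  have AB0 : mu (A `|` B) = 0%E by exact: null_set_setU.
  have nAB x : ~ (A `|` B) x -> g m x = f m x /\ g 0 x = 0.
    move=> /not_orP[nA nB]; split; apply: contrapT => h.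
      by apply: nA; exact: subA.
    by apply: nB; exact: subB.
  apply: fourier_energy_ae => //; try exact: measurable_funB.
  - exists (A `|` B); split=> // x /= h; apply: contrapT => /nAB[e1 e2].
    by apply: h; rewrite e1 e2 subr0.
  - exists (A `|` B); split=> // x /= h; apply: contrapT => /nAB[e1 e2].
    by apply: h; rewrite e1 e2 subr0.
have al0 : 0 <= alpha * l by rewrite mulr_ge0// ltW.
have hardy := fractional_hardy s_gt mG G01 G_full mN N0 md d0
  (fun eta m m' eta0 _ _ => fourier_energy_triangle _ _ _ _ eta0) N1' d1' Nvan al0 als.
pose K : R := 32 * (2 * T * c1) `^ (- l).
have K0 : 0 <= K by rewrite mulr_ge0// powR_ge0.
pose A m := (K%:E * ((m `^ (- (alpha * l)))%:E * N m))%E.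
have mw : measurable_fun setT (fun m : R => ((m `^ (- (alpha * l)))%:E * N m)%E).
  by apply: emeasurable_funM => //; apply/measurable_EFinP.
have w0 m : (0 <= (m `^ (- (alpha * l)))%:E * N m)%E.
  by apply: mule_ge0; rewrite ?lee_fin ?powR_ge0.
have mA : measurable_fun setT A by exact: measurable_funeM.
have A0 m : (0 <= A m)%E by exact: mule_ge0.
(* A measurable majorant valid for every [m]: off the null set it is the pointwise
   estimate, and on the null set the value +oo costs nothing. *)
pose W := ((A \_ G) \+ (cst +oo \_ (~` G)))%E.
have WG m : G m -> W m = A m.
  move=> Gm; have nG : ~ (~` G) m by move=> /(_ Gm).
  by rewrite /W /= !patchE (mem_set Gm) (memNset nG) adde0.
have WN m : ~ G m -> W m = +oo%E.
  by move=> nG; rewrite /W /= !patchE memNset// mem_set// add0e.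
have W0 m : (0 <= W m)%E.
  by have [/WG->|/WN->] := pselect (G m).
have mW : measurable_fun setT W.
  apply: emeasurable_funD.
  - by apply/(measurable_restrictT _ _).1 => //; exact: measurable_funTS.
  - by apply/(measurable_restrictT _ _).1 => //; exact: measurableC.
have ptw (p : R * R) : (unitI `*` unitI) p ->
    (sqmod (time_average phi T f p.1 p.2) <= W p.1)%E.
  move: p => [m x] [/= m01 x01]; have [Gm|/WN->] := pselect (G m); last exact: leey.
  have := G01 _ Gm; rewrite /= in_itv/= => /andP[m0 m1].
  have cm0 : 0 < c1 * m `^ alpha by rewrite mulr_gt0// powR_gt0.
  have phi0 : 0 < phi m := lt_le_trans cm0 (phi_ge m m0 m1).
  rewrite WG//; apply: le_trans (sqmod_time_average_le x (GH m Gm) phi0 T0 l0 l2) _.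
  rewrite /A muleA /N UE// VE//; apply: lee_wpmul2r; first exact: fourier_energy_ge0.
  rewrite -EFinM lee_fin /K -[leRHS]mulrA; apply: ler_wpM2l => //.
  have -> : (2 * T * c1) `^ (- l) * m `^ (- (alpha * l)) =
      (2 * T * (c1 * m `^ alpha)) `^ (- l).
    rewrite -mulrN powRrM -powRM ?powR_ge0 ?mulr_ge0 ?ltW//.
    by rewrite mulrA.
  have T2 : 0 < 2 * T by rewrite mulr_gt0.
  have z1 : 0 < 2 * T * (c1 * m `^ alpha) by rewrite mulr_gt0.
  have z2 : 0 < 2 * T * phi m by rewrite mulr_gt0.
  rewrite !powRN lef_pV2 ?posrE ?powR_gt0//.
  apply: ge0_ler_powR => //; rewrite ?nnegrE ?(ltW z1) ?(ltW z2) //.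
  by rewrite ler_pM2l// phi_ge.
have sq0 (p : R * R) : (0 <= sqmod (time_average phi T f p.1 p.2))%E.
  by rewrite sqmodE lee_fin addr_ge0 ?sqr_ge0.
apply: (@le_trans _ _
    (\int[(mu \x mu)%E]_(p in unitI `*` unitI) W p.1)%E).
  by apply: ge0_le_integral_lower.
rewrite integral_square_fst//.
have -> : (\int[mu]_(m in unitI) W m = \int[mu]_(m in G) A m)%E.
  rewrite (@ge0_negligible_integral _ _ _ mu unitI (unitI `\` G))//.
  - rewrite setDD (_ : unitI `&` G = G); last first.
      by apply/setIidr => m /GI.
    by apply: eq_integral => m /set_mem/WG.
  - exact: measurableD.
  - exact: measurable_funTS.
  have sub : unitI `\` G `<=` [set 0] `|` (`]0, 1]%classic `\` G).
    move=> m [/=]; rewrite in_itv/= => /andP[m0 m1] nG.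
    have [->|mn0] := eqVneq m 0; first by left.
    by right; split=> //=; rewrite in_itv/= m1 lt_neqAle eq_sym mn0 m0.
  have mD1 : measurable (`]0, 1]%classic `\` G) by exact: measurableD.
  apply: (@subset_measure0 _ _ _ mu _ _ _ _ sub) => //.
  - exact: measurableD.
  - exact: measurableU.
  - by apply: null_set_setU => //; exact: lebesgue_measure_set1.
rewrite ge0_integralZl//; last exact: measurable_funTS.
rewrite -/K [leRHS]EFinM; apply: lee_wpmul2l; last exact: hardy.
by rewrite lee_fin.
Qed.

End Core.

Theorem theorem1p3 (R : realType) (phi : R -> R)
  (phi_ge0 : forall m, m \in `[0, 1] -> 0 <= phi m)
  (m0 c alpha : R) (m0_gt0 : 0 < m0) (c_gt0 : 0 < c) (alpha_gt0 : 0 < alpha)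
  (phi_power : forall m, m \in `[0, 1] -> m < m0 -> phi m = c * m `^ alpha)
  (phi_cont : {within `[m0, 1], continuous phi})
  (phi_away : exists2 delta, 0 < delta &
     forall m, m \in `[m0, 1] -> delta <= phi m) :
  exists s gamma : R,
    [/\ 2^-1 < s, s < 1, 0 <= gamma, 2^-1 < gamma + s / alpha &
        forall eps : R, 0 < eps ->
          let l := Num.min (2 * s / alpha - eps) 2 in
          exists2 C : R, 0 < C & forall T : R, 1 < T ->
            (opnorm_calH0_L2 s gamma (time_average phi T)
               <= (C * T `^ (- (l / 2)))%:E)%E].
Proof.
pose s : R := 3 / 4; exists s, 1.
have s0 : 0 < s by rewrite /s; lra.
have s_gt : 2^-1 < s by rewrite /s; lra.
have sa : 0 < s / alpha by rewrite divr_gt0.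
split=> //; [by rewrite /s; lra|by lra|].
move=> eps eps0 l.
have [delta delta0 phi_delta] := phi_away.
(* Beyond [m0] the lower bound [delta] also dominates [delta * m `^ alpha], because
   [m <= 1]. *)
pose c1 := Num.min c delta.
have c1_gt0 : 0 < c1 by rewrite lt_min c_gt0.
have phi_ge m : 0 < m -> m <= 1 -> c1 * m `^ alpha <= phi m.
  move=> mpos m1; have p0 : 0 <= m `^ alpha by exact: powR_ge0.
  have [mm0|m0m] := ltP m m0.
    rewrite phi_power//; last by rewrite in_itv/= m1 ltW.
    by rewrite ler_wpM2r// ge_min lexx.
  apply: (@le_trans _ _ delta); last by rewrite phi_delta// in_itv/= m0m.
  apply: (@le_trans _ _ c1); last by rewrite ge_min lexx orbT.
  rewrite ler_piMr ?(ltW c1_gt0)//.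
  have := @ge0_ler_powR R alpha (ltW alpha_gt0) m 1; rewrite powR1 !nnegrE.
  by apply=> //; exact: ltW.
(* For large [eps] the exponent [l] is negative; since [1 < T] it is enough to
   prove the estimate with the exponent 0. *)
pose l' := Num.max l 0.
have l'0 : 0 <= l' by rewrite le_max lexx orbT.
have l'2 : l' <= 2 by rewrite ge_max !ge_min lexx orbT/=.
have al' : alpha * l' < 2 * s.
  rewrite /l' /Num.max; case: ifP => _; first by rewrite mulr0 mulr_gt0.
  apply: (@le_lt_trans _ _ (alpha * (2 * s / alpha - eps))).
    by rewrite ler_pM2l// ge_min lexx.
  rewrite mulrBr mulrC divfK ?gt_eqF// ltrBlDr ltrDl.
  by rewrite mulr_gt0.
pose K := 32 * (2 * c1) `^ (- l') * hardy_const s (alpha * l').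
have K0 : 0 <= K.
  by rewrite mulr_ge0 ?hardy_const_ge0// mulr_ge0// powR_ge0.
exists (Num.sqrt (K + 1)); first by rewrite sqrtr_gt0; lra.
move=> T T1; have T0 : 0 < T by lra.
apply: ge_ereal_sup => _ [f [Hf f1] <-].
have := time_average_sqnorm_le s_gt c1_gt0 T0 phi_ge alpha_gt0 l'0 l'2 al' Hf f1.
rewrite /L2_annulus_norm.
set I := (\int[_]_(p in _) _)%E => HI.
set B := Num.sqrt (K + 1) * T `^ (- (l / 2)).
have B0 : 0 <= B by rewrite mulr_ge0 ?sqrtr_ge0 ?powR_ge0.
have -> : B%:E = sqrte ((B ^+ 2)%:E).
  by rewrite EFin_expe sqrte_sqr gee0_abs.
rewrite lee_sqrt ?lee_fin ?sqr_ge0//; apply: (le_trans HI); rewrite lee_fin.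
rewrite /B exprMn sqr_sqrtr; last by lra.
have -> : (T `^ (- (l / 2))) ^+ 2 = T `^ (- l).
  rewrite -powR_mulrn ?powR_ge0// -powRrM; congr (_ `^ _).
  by rewrite mulNr divfK.
have -> : 32 * (2 * T * c1) `^ (- l') * hardy_const s (alpha * l') = K * T `^ (- l').
  rewrite (_ : 2 * T * c1 = 2 * c1 * T); last by rewrite mulrAC.
  have c2 : 0 <= 2 * c1 by rewrite mulr_ge0 ?(ltW c1_gt0).
  by rewrite powRM ?(ltW T0)// /K mulrA [LHS]mulrAC.
apply: ler_pM => //; first exact: powR_ge0.
  by rewrite lerDl.
by rewrite ler_powR ?(ltW T1)// lerN2 le_max lexx.
Qed.
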